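(* Let $(M,g)$ be a connected, oriented, time oriented, globally hyperbolic Lorentz manifold without boundary of dimension $n\geq 3$, and let $(N,h)$ be an $n$-dimensional Lorentz manifold without boundary, where the manifolds and the metrics are $C^\infty$ smooth. Let $S$ be a $C^\infty$ smooth spacelike Cauchy hypersurface in $M$ and let $\Omega$ be a subset of $S$. Assume that $F_1,F_2:M\to N$ are two $C^\infty$ smooth locally diffeomorphic conformal mappings, $F_1^*h=c_1g$ and $F_2^*h=c_2g$ for functions $c_1,c_2$ on $M$, and that $F_1$ and $F_2$ agree to second order on $\Omega$. Then $F_1(p)=F_2(p)$ for all $p\in\mathcal{D}^+(\Omega)\cup\mathcal{D}^-(\Omega)$. In particular, if $\Omega=S$, then $F_1=F_2$ in $M$.
   Context: $\mathcal{D}^+(\Omega)$ (respectively $\mathcal{D}^-(\Omega)$) is the future (respectively past) Cauchy development of $\Omega$: the set of points $p\in M$ such that every past (respectively future) inextendible causal curve through $p$ intersects $\Omega$. Two mappings $F_1,F_2:M\to N$ agree to second order on a set $\Xi\subset M$ if $F_1|_\Xi=F_2|_\Xi$ and if for each $p\in\Xi$ there are coordinates $(x^1,\ldots,x^n)$ and $(y^1,\ldots,y^n)$ on neighborhoods of $p$ in $M$ and of $F_1(p)=F_2(p)$ in $N$ respectively such that, in these coordinates, at all points $x\in\Xi$ of the coordinate neighborhood, $\partial_{x_a}F_1^l(x)=\partial_{x_a}F_2^l(x)$ and $\partial_{x_a}\partial_{x_b}F_1^l(x)=\partial_{x_a}\partial_{x_b}F_2^l(x)$ for all $a,b,l=1,\ldots,n$.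 *)

(* Defs.v *)
From HB Require Import structures.
From mathcomp Require Import all_boot all_order all_algebra.
From mathcomp Require Import all_classical all_reals all_analysis.

Set Implicit Arguments.
Unset Strict Implicit.
Unset Printing Implicit Defensive.

Import Order.TTheory GRing.Theory Num.Theory.
Import numFieldNormedType.Exports.

Local Open Scope classical_set_scope.
Local Open Scope ring_scope.

(* Conventions: tangent vectors are row vectors of components in a chart; a
   tensor field is the family of its components in all charts, subject to the
   transformation law.  If J = 'J (y \o x^-1) is the Jacobian of a coordinate
   change, the row v of components in x becomes v *m J in y, and a bilinear
   form with matrix B in y has matrix J *m B *m J^T in x.  The signature of a
   Lorentz metric is (-, +, ..., +). *)

Section Smoothness.
Context {R : realType} {V W : normedModType R}.

(* These are meant for an open set A; the values of f outside A are
   irrelevant. *)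
Fixpoint Ck_on (k : nat) (A : set V) (f : V -> W) : Prop :=
  match k with
  | 0 => forall x, A x -> {for x, continuous f}
  | k'.+1 => (forall x, A x -> differentiable f x) /\
             (forall v : V, Ck_on k' A (fun x => 'D_v f x))
  end.

Definition smooth_on (A : set V) (f : V -> W) : Prop :=
  forall k, Ck_on k A f.

End Smoothness.

(* [chart_map] and [chart_inv] are total functions, but only their values on
   [chart_dom] and on its image are meaningful. *)
Record chart (R : realType) (n : nat) (T : topologicalType) := Chart {
  chart_dom : set T;
  chart_map : T -> 'rV[R]_n;
  chart_inv : 'rV[R]_n -> T }.

Section Charts.
Context {R : realType} {n : nat} {T : topologicalType}.
Implicit Types x y : chart R n T.

Definition chart_img x : set 'rV[R]_n := chart_map x @` chart_dom x.

Definition is_chart x : Prop :=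
  [/\ open (chart_dom x),
      open (chart_img x),
      (forall p, chart_dom x p -> chart_inv x (chart_map x p) = p),
      (forall p, chart_dom x p -> {for p, continuous (chart_map x)}) &
      (forall v, chart_img x v -> {for v, continuous (chart_inv x)})].

Definition transition x y : 'rV[R]_n -> 'rV[R]_n := chart_map y \o chart_inv x.

Definition smooth_transition x y : Prop :=
  smooth_on (chart_map x @` (chart_dom x `&` chart_dom y)) (transition x y).

Definition transition_jac x y (p : T) : 'M[R]_n :=
  'J (transition x y) (chart_map x p).

End Charts.

(* A smooth structure is a maximal smooth atlas. *)
Record manifold (R : realType) (n : nat) := Manifold {
  manifold_sort :> topologicalType;
  atlas : set (chart R n manifold_sort);
  manifold_hausdorff : hausdorff_space manifold_sort;
  manifold_second_countable : @second_countable manifold_sort;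
  atlas_chart : forall x, atlas x -> is_chart x;
  atlas_cover : forall p, exists2 x, atlas x & chart_dom x p;
  atlas_compatible : forall x y, atlas x -> atlas y -> smooth_transition x y;
  atlas_maximal : forall x, is_chart x ->
    (forall y, atlas y -> smooth_transition x y /\ smooth_transition y x) ->
    atlas x }.

Definition is_orientation (R : realType) (n : nat) (M : manifold R n)
    (O : set (chart R n M)) : Prop :=
  [/\ O `<=` @atlas R n M,
      (forall p : M, exists2 x, O x & chart_dom x p) &
      (forall x y p, O x -> O y -> chart_dom x p -> chart_dom y p ->
         0 < \det (transition_jac x y p))].

Section Maps.
Context {R : realType} {m n : nat} {M : manifold R m} {N : manifold R n}.
Implicit Types (F : M -> N) (x : chart R m M) (y : chart R n N).

Definition local_rep F x y : 'rV[R]_m -> 'rV[R]_n :=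
  chart_map y \o F \o chart_inv x.

Definition smooth_map_on (U : set M) F : Prop :=
  (forall p, U p -> {for p, continuous F}) /\
  (forall x y, atlas x -> atlas y ->
     smooth_on (chart_map x @` (U `&` chart_dom x `&` F @^-1` chart_dom y))
               (local_rep F x y)).

Definition smooth_map F : Prop := smooth_map_on setT F.

End Maps.

Definition local_diffeo (R : realType) (n : nat) (M N : manifold R n)
    (F : M -> N) : Prop :=
  smooth_map F /\
  forall p : M, exists (U : set M) (G : N -> M),
    [/\ open U, U p, open (F @` U),
        (forall q, U q -> G (F q) = q) &
        smooth_map_on (F @` U) G].

Definition partial (R : realType) (n : nat) (a : 'I_n) (f : 'rV[R]_n -> R) :
  'rV[R]_n -> R := fun v => 'D_(delta_mx 0 a) f v.

Definition agree_to_second_order (R : realType) (n : nat) (M N : manifold R n)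
    (F1 F2 : M -> N) (Xi : set M) : Prop :=
  (forall p, Xi p -> F1 p = F2 p) /\
  forall p, Xi p -> exists (x : chart R n M) (y : chart R n N),
    [/\ atlas x /\ atlas y,
        chart_dom x p,
        chart_dom y (F1 p),
        (F1 @` chart_dom x `<=` chart_dom y) /\
        (F2 @` chart_dom x `<=` chart_dom y) &
        forall q, Xi q -> chart_dom x q ->
          let v := chart_map x q in
          let f1 l := fun w => local_rep F1 x y w 0 l in
          let f2 l := fun w => local_rep F2 x y w 0 l in
          forall a b l : 'I_n,
            partial a (f1 l) v = partial a (f2 l) v /\
            partial a (partial b (f1 l)) v = partial a (partial b (f2 l)) v].

Definition minkowski_mx (R : realType) (n : nat) : 'M[R]_n :=
  diag_mx (\row_(i < n) (if i == 0%N :> nat then -1 else 1)).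

Definition lorentzian_mx (R : realType) (n : nat) (B : 'M[R]_n) : Prop :=
  exists2 P : 'M[R]_n, P \in unitmx & P *m B *m P^T = minkowski_mx R n.

Record lorentz_metric (R : realType) (n : nat) (M : manifold R n) :=
  LorentzMetric {
    metric_mx :> chart R n M -> M -> 'M[R]_n;
    metric_smooth : forall x, atlas x ->
      smooth_on (chart_img x) (metric_mx x \o chart_inv x);
    metric_transform : forall x y p, atlas x -> atlas y ->
      chart_dom x p -> chart_dom y p ->
      metric_mx x p =
        transition_jac x y p *m metric_mx y p *m (transition_jac x y p)^T;
    metric_signature : forall x p, atlas x -> chart_dom x p ->
      lorentzian_mx (metric_mx x p) }.

(* The pulled-back metric is computed in charts.  No sign, regularity or
   nonvanishing of the factor c is required. *)
Definition conformal_with (R : realType) (m n : nat) (M : manifold R m)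
    (N : manifold R n) (g : lorentz_metric M) (h : lorentz_metric N)
    (F : M -> N) (c : M -> R) : Prop :=
  forall x y p, atlas x -> atlas y -> chart_dom x p -> chart_dom y (F p) ->
    let J := 'J (local_rep F x y) (chart_map x p) in
    J *m h y (F p) *m J^T = c p *: g x p.

Section Vectors.
Context {R : realType} {n : nat} {M : manifold R n} (g : lorentz_metric M).

Definition inner (x : chart R n M) (p : M) (u v : 'rV[R]_n) : R :=
  (u *m g x p *m v^T) 0 0.

Definition timelike x p v : Prop := inner x p v v < 0.
Definition causal x p v : Prop := v != 0 /\ inner x p v v <= 0.

(* A time orientation, given by a smooth timelike vector field. *)
Record time_orientation := TimeOrientation {
  time_field :> chart R n M -> M -> 'rV[R]_n;
  time_field_smooth : forall x, atlas x ->
    smooth_on (chart_img x) (time_field x \o chart_inv x);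
  time_field_transform : forall x y p, atlas x -> atlas y ->
    chart_dom x p -> chart_dom y p ->
    time_field y p = time_field x p *m transition_jac x y p;
  time_field_timelike : forall x p, atlas x -> chart_dom x p ->
    timelike x p (time_field x p) }.

Definition future_timelike (X : time_orientation) x p v : Prop :=
  timelike x p v /\ inner x p (X x p) v < 0.
Definition future_causal (X : time_orientation) x p v : Prop :=
  causal x p v /\ inner x p (X x p) v < 0.

End Vectors.

Section Curves.
Context {R : realType} {n : nat} {M : manifold R n}.
Implicit Types (K : chart R n M -> M -> 'rV[R]_n -> Prop) (c : R -> M).

(* c is smooth on the closed interval [a, b] with velocity in K: near each t
   of [a, b] it is the restriction to [a, b] of a curve u smooth on a
   neighborhood of t, so that at a and b the velocity is one-sided. *)
Definition smooth_piece K c (a b : R) : Prop :=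
  forall t, a <= t <= b ->
    exists (x : chart R n M) (u : R -> 'rV[R]_n) (U : set R),
      [/\ atlas x /\ chart_dom x (c t),
          open U /\ U t,
          smooth_on U u,
          (forall s, U s -> a <= s <= b ->
             chart_dom x (c s) /\ chart_map x (c s) = u s) &
          K x (c t) ('D_1 u t)].

(* Curves c : I -> M on a nondegenerate interval I (open or closed at either
   end, possibly unbounded), smooth up to finitely many breaks on each compact
   subinterval, all of whose (one-sided) velocities lie in K. *)
Definition piecewise_smooth_curve K c (I : set R) : Prop :=
  [/\ is_interval I,
      (exists a b, [/\ I a, I b & a < b]) &
      forall a b, I a -> I b -> a < b ->
        exists (k : nat) (t : nat -> R),
          [/\ t 0%N = a, t k = b &
              forall i, (i < k)%N ->
                t i < t i.+1 /\ smooth_piece K c (t i) (t i.+1)]].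

Definition past_endpoint c (I : set R) (q : M) : Prop :=
  forall U : set M, nbhs q U ->
    exists2 t0, I t0 & forall t, I t -> t <= t0 -> U (c t).

Definition future_endpoint c (I : set R) (q : M) : Prop :=
  forall U : set M, nbhs q U ->
    exists2 t0, I t0 & forall t, I t -> t0 <= t -> U (c t).

Definition past_inextendible c I : Prop := ~ exists q, past_endpoint c I q.
Definition future_inextendible c I : Prop := ~ exists q, future_endpoint c I q.

End Curves.

Section Causality.
Context {R : realType} {n : nat} {M : manifold R n}.
Context (g : lorentz_metric M) (X : time_orientation g).

(* Timelike and causal curves are parametrized towards the future. *)
Definition timelike_curve (c : R -> M) (I : set R) : Prop :=
  piecewise_smooth_curve (future_timelike X) c I.
Definition causal_curve (c : R -> M) (I : set R) : Prop :=
  piecewise_smooth_curve (future_causal X) c I.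

Definition causal_le (p q : M) : Prop :=
  p = q \/ exists (c : R -> M) (a b : R),
    [/\ a < b, causal_curve c `[a, b], c a = p & c b = q].

Definition globally_hyperbolic : Prop :=
  (~ exists (c : R -> M) (a b : R),
       [/\ a < b, causal_curve c `[a, b] & c a = c b]) /\
  (forall p q : M, compact [set z | causal_le p z /\ causal_le z q]).

Definition cauchy_set (S : set M) : Prop :=
  forall c I, timelike_curve c I -> past_inextendible c I ->
    future_inextendible c I -> exists! t, I t /\ S (c t).

Definition slice_chart (S : set M) (x : chart R n M) (i : 'I_n) : Prop :=
  atlas x /\ forall q, chart_dom x q -> (S q <-> chart_map x q 0 i = 0).

Definition smooth_hypersurface (S : set M) : Prop :=
  forall p, S p -> exists x i, slice_chart S x i /\ chart_dom x p.

(* In a slice chart the tangent space of S is the hyperplane v_i = 0. *)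
Definition spacelike (S : set M) : Prop :=
  forall x i p (v : 'rV[R]_n), slice_chart S x i -> chart_dom x p -> S p ->
    v 0 i = 0 -> v != 0 -> 0 < inner g x p v v.

Definition spacelike_cauchy_hypersurface (S : set M) : Prop :=
  [/\ smooth_hypersurface S, spacelike S & cauchy_set S].

Definition future_cauchy_development (Omega : set M) : set M :=
  [set p | forall c I, causal_curve c I -> past_inextendible c I ->
     (exists2 t, I t & c t = p) -> exists2 s, I s & Omega (c s)].

Definition past_cauchy_development (Omega : set M) : set M :=
  [set p | forall c I, causal_curve c I -> future_inextendible c I ->
     (exists2 t, I t & c t = p) -> exists2 s, I s & Omega (c s)].

End Causality.

(* Main.v *)
Require Import Defs.
From HB Require Import structures.
From mathcomp Require Import all_boot all_order all_algebra.
From mathcomp Require Import all_classical all_reals all_analysis.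
From mathcomp Require Import ring lra zify.

Set Implicit Arguments.
Unset Strict Implicit.
Unset Printing Implicit Defensive.

Import Order.TTheory GRing.Theory Num.Theory.
Import numFieldNormedType.Exports.

Local Open Scope classical_set_scope.
Local Open Scope ring_scope.

(* A conformal local diffeomorphism in dimension at least 3 is determined by
   its 2-jet at one point.  In charts, J h(f) J^T = c g.  One derivative
   expresses f'' through (f, f', c'), as for the Christoffel symbols; in a
   second derivative, the symmetry of f''' gives a linear equation
     c_kj g_ab - c_bj g_ak - c_ka g_jb + c_ba g_jk = (terms in the 2-jet of f),
   whose two contractions determine c'' because n - 2 and 2 n - 2 do not vanish.
   So f''' is a locally Lipschitz function of the 2-jet of f, and by Gronwall on
   coordinate lines, two maps with the same 2-jet at p agree near p.  The set
   where F1 and F2 agree near the point is then open and closed, hence F1 = F2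
   as soon as Omega is not empty.  Omega is indeed not empty if it is a Cauchy
   set or has a nonempty Cauchy development, since an inextendible timelike
   curve passes through every point: it is built from straight segments in
   charts, leaving each set of a countable basis infinitely often. *)

(** * Partial derivatives and smooth functions *)

(** No regularity of the conformal factor is assumed. It is recovered as a component of the
    pulled-back metric divided by a nonvanishing component of [g]; hence it is smooth and depends on
    the 1-jet of the map. Its Hessian therefore contains third derivatives of the map and cannot be
    put among the lower-order terms, which is why it has to be eliminated by traces. No formula for
    f''' in terms of the 2-jet is ever written. The same expressions are evaluated at both maps, and
    the differences are bounded by [e k], the size of the k-jet of f1 - f2. Products, derivatives
    and compositions with a fixed smooth function propagate such bounds mechanically, the level k
    counting the derivatives of the map involved. The Lipschitz property is thus used only between
    the two given maps. Agreement is propagated as equality of germs: openness is then immediate,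
    and at a limit point the 2-jets agree by continuity. *)

Section Partial.
Context {R : realType}.

(** The differential of [f] also provides the first-order expansion of [g], and by uniqueness it is
    ['d g x]. *)
Lemma near_eq_differentiable (V W : normedModType R) (f g : V -> W) (x : V) :
  {near x, f =1 g} -> differentiable f x -> differentiable g x.
Proof.
move=> fg df.
have fgx : f x = g x by exact: nbhs_singleton fg.
have dc : continuous ('d f x : V -> W) by exact: diff_continuous.
have H : g \o shift x = cst (g x) + ('d f x : V -> W) +o_ 0 (@idfun V).
  apply/eqaddoP => e e0.
  have := diff_locally df => /eqaddoP /(_ e e0) H.
  have fg0 : \forall h \near (0 : V), f (h + x) = g (h + x).
    by move: fg; rewrite (near_shift 0 x) /=; apply: filterS => h /=; rewrite subr0.
  near=> h.
  have Hh : `|(f \o shift x - (cst (f x) + 'd f x)) h| <= e * `|h| by near: h.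
  have Eh : f (h + x) = g (h + x) by near: h.
  move: Hh; rewrite !fctE /= Eh fgx; exact.
have Hd := diff_unique dc H.
apply/diff_locallyP; rewrite Hd; split => //.
Unshelve. all: by end_near.
Qed.

Lemma derive_partial n (u : 'rV[R]_n -> R) x v : differentiable u x ->
  'D_v u x = \sum_a v 0 a * partial a u x.
Proof.
move=> du; rewrite deriveE // {1}(row_sum_delta v) linear_sum /=.
by apply: eq_bigr => a _; rewrite linearZ /= /partial deriveE.
Qed.

Lemma partial_comp m n (f : 'rV[R]_m -> 'rV[R]_n) (w : 'rV[R]_n -> R) a x :
  differentiable f x -> differentiable w (f x) ->
  partial a (w \o f) x =
  \sum_r partial a (fun z => f z 0 r) x * partial r w (f x).
Proof.
move=> df dw; rewrite /partial deriveE; last exact: differentiable_comp.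
rewrite diff_comp //= -(deriveE _ df) -deriveE //.
rewrite derive_partial //; apply: eq_bigr => r _; congr (_ * _).
by rewrite derive_mx ?mxE //; exact: diff_derivable.
Qed.

Lemma differentiable_row m n (f : 'rV[R]_m -> 'rV[R]_n) x :
  (forall r, differentiable (fun z => f z 0 r) x) -> differentiable f x.
Proof.
move=> df.
have -> : f = \sum_r (fun z => f z 0 r *: (delta_mx 0 r : 'rV_n)).
  by apply/funext => z; rewrite {1}(row_sum_delta (f z)) fct_sumE.
by apply: differentiable_sum => r; apply: differentiableZl.
Qed.

Lemma jacobianE m n (f : 'rV[R]_m -> 'rV[R]_n) v a l : differentiable f v ->
  'J f v a l = partial a (fun z => f z 0 l) v.
Proof.
move=> df; rewrite /partial.
have <- : ('D_(delta_mx 0 a) f v) 0 l = 'D_(delta_mx 0 a) (fun z => f z 0 l) v.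
  by rewrite derive_mx ?mxE //; exact: diff_derivable.
by rewrite deriveEjacobian // -rowE [RHS]mxE.
Qed.

End Partial.

(** * Scalar C^k functions on open sets of coordinate space *)

Section Cr.
Context {R : realType}.

(** Scalar values and coordinate directions replace the vector values and arbitrary directions of
    [Ck_on], so that sums, products and quotients can be handled; [smooth_on_Cr] converts the
    components of metrics, vector fields and local representatives. *)
Fixpoint Cr n k (A : set 'rV[R]_n) (u : 'rV[R]_n -> R) : Prop :=
  match k with
  | 0 => forall x, A x -> {for x, continuous u}
  | k'.+1 => (forall x, A x -> differentiable u x) /\
             forall a, Cr k' A (partial a u)
  end.

Lemma near_eq_on (V : topologicalType) (W : Type) (A : set V) (u w : V -> W) x :
  open A -> (forall x, A x -> u x = w x) -> A x -> {near x, u =1 w}.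
Proof.
by move=> oA uw Ax; apply: filterS (open_nbhs_nbhs (conj oA Ax)); exact: uw.
Qed.

Lemma eq_partial n (A : set 'rV[R]_n) (u w : 'rV[R]_n -> R) a x :
  open A -> (forall x, A x -> u x = w x) -> A x -> partial a u x = partial a w x.
Proof. by move=> oA uw Ax; exact/near_eq_derive/(near_eq_on oA uw). Qed.

(** On an open set, equality of functions is equality of germs and so passes to derivatives. The
    closure lemmas below need this because the Leibniz-type formulas are known only on [A]. *)
Lemma eq_Cr n k (A : set 'rV[R]_n) (u w : 'rV[R]_n -> R) :
  open A -> (forall x, A x -> u x = w x) -> Cr k A u -> Cr k A w.
Proof.
move=> oA; elim: k u w => [|k IH] u w uw /=.
  move=> cu x Ax; rewrite /prop_for /continuous_at -uw //.
  exact: cvg_trans (near_eq_cvg (near_eq_on oA uw Ax)) (cu x Ax).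
move=> [du cu]; split=> [x Ax|a].
  exact: near_eq_differentiable (near_eq_on oA uw Ax) (du x Ax).
by apply: IH (cu a) => x Ax; exact: eq_partial oA uw Ax.
Qed.

Lemma Cr_continuous n k (A : set 'rV[R]_n) u x : Cr k A u -> A x -> {for x, continuous u}.
Proof.
case: k => [|k] /=; first exact.
by move=> [du _] Ax; exact/differentiable_continuous/du.
Qed.

Lemma Cr_pred n k (A : set 'rV[R]_n) u : Cr k.+1 A u -> Cr k A u.
Proof.
elim: k u => [|k IH] u.
  by move=> [du _] x Ax; exact/differentiable_continuous/du.
by move=> [du cu]; split => // a; exact/IH/cu.
Qed.

Lemma Cr_sub n k (A B : set 'rV[R]_n) u : A `<=` B -> Cr k B u -> Cr k A u.
Proof.
move=> AB; elim: k u => [|k IH] u /=; first by move=> cu x /AB /cu.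
by move=> [du cu]; split=> [x /AB /du|a]//; exact/IH/cu.
Qed.

Lemma Cr_cst n k (A : set 'rV[R]_n) (c : R) : Cr k A (cst c).
Proof.
elim: k c => [|k IH] c /=; first by move=> x _; exact: cst_continuous.
split=> [x _|a]; first exact: differentiable_cst.
by have -> : partial a (cst c : 'rV[R]_n -> R) = cst 0
  by apply/funext => x; exact: derive_cst.
Qed.

Lemma partialD n (u w : 'rV[R]_n -> R) a x : differentiable u x -> differentiable w x ->
  partial a (u \+ w) x = partial a u x + partial a w x.
Proof.
by move=> du dw; rewrite /partial -deriveD //; exact: diff_derivable.
Qed.

Lemma partialM n (u w : 'rV[R]_n -> R) a x : differentiable u x -> differentiable w x ->
  partial a (u \* w) x = partial a u x * w x + u x * partial a w x.
Proof.
move=> du dw; rewrite /partial [LHS]deriveM; [|exact: diff_derivable..].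
by rewrite addrC; congr (_ + _); exact: mulrC.
Qed.

Lemma partialB n (u w : 'rV[R]_n -> R) a x : differentiable u x -> differentiable w x ->
  partial a (u \- w) x = partial a u x - partial a w x.
Proof.
by move=> du dw; rewrite /partial -deriveB //; exact: diff_derivable.
Qed.

Lemma partial_sum n m (u : 'I_m -> 'rV[R]_n -> R) a x :
  (forall i, differentiable (u i) x) ->
  partial a (fun x => \sum_i u i x) x = \sum_i partial a (u i) x.
Proof.
move=> du; rewrite /partial -derive_sum; last by move=> i; exact: diff_derivable.
by congr (derive _ _ _); apply/funext => z; rewrite fct_sumE.
Qed.

Section OpenSet.
Variables (n : nat) (A : set 'rV[R]_n).
Hypothesis oA : open A.
Implicit Types (u w : 'rV[R]_n -> R).

Lemma CrD k u w : Cr k A u -> Cr k A w -> Cr k A (u \+ w).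
Proof.
elim: k u w => [|k IH] u w /=.
  by move=> cu cw x Ax; apply: continuousD; [exact: cu|exact: cw].
move=> [du cu] [dw cw]; split=> [x Ax|a].
  by apply: differentiableD; [exact: du|exact: dw].
apply: (eq_Cr oA) (IH _ _ (cu a) (cw a)) => x Ax.
by rewrite partialD //; [exact: du|exact: dw].
Qed.

Lemma CrM k u w : Cr k A u -> Cr k A w -> Cr k A (u \* w).
Proof.
elim: k u w => [|k IH] u w.
  by move=> cu cw x Ax; apply: continuousM; [exact: cu|exact: cw].
move=> Cu Cw; have [du cu] := Cu; have [dw cw] := Cw.
split=> [x Ax|a]; first by apply: differentiableM; [exact: du|exact: dw].
apply: (eq_Cr oA) (CrD (IH _ _ (cu a) (Cr_pred Cw)) (IH _ _ (Cr_pred Cu) (cw a))).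
by move=> x Ax; rewrite partialM //; [exact: du|exact: dw].
Qed.

Lemma CrN k u : Cr k A u -> Cr k A (\- u).
Proof.
move=> Cu; apply: (eq_Cr oA) (CrM (@Cr_cst n k A (-1)) Cu) => x _ /=.
by rewrite /cst mulN1r.
Qed.

Lemma CrB k u w : Cr k A u -> Cr k A w -> Cr k A (u \- w).
Proof. by move=> Cu Cw; exact: CrD Cu (CrN Cw). Qed.

Lemma Cr_sum k (I : finType) (u : I -> 'rV[R]_n -> R) :
  (forall i, Cr k A (u i)) -> Cr k A (fun x => \sum_i u i x).
Proof.
move=> Cu; rewrite (_ : (fun _ => _) = \sum_i u i); last first.
  by apply/funext => z; rewrite fct_sumE.
by elim/big_ind: _ => //; [exact: (@Cr_cst n k A 0)|move=> *; exact: CrD].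
Qed.

Lemma Cr_prod k (I : finType) (u : I -> 'rV[R]_n -> R) :
  (forall i, Cr k A (u i)) -> Cr k A (fun x => \prod_i u i x).
Proof.
move=> Cu; elim: (index_enum I) => [|i r IH].
  by apply: (eq_Cr oA) (@Cr_cst n k A 1) => x _; rewrite big_nil.
by apply: (eq_Cr oA) (CrM (Cu i) IH) => x _; rewrite big_cons.
Qed.

(** The derivative of 1/u is -(1/u)^2 u', so one order of regularity for 1/u follows from the
    preceding one. *)
Lemma CrV k u : (forall x, A x -> u x != 0) -> Cr k A u -> Cr k A (fun x => (u x)^-1).
Proof.
move=> u0; elim: k => [|k IH].
  by move=> cu x Ax; apply: continuousV; [exact: u0|exact: cu].
move=> Cu; have [du cu] := Cu; have Vu := IH (Cr_pred Cu).
split=> [x Ax|a]; first by apply: (@differentiableV _ _ u); [exact: du|exact: u0].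
apply: (eq_Cr oA) (CrN (CrM (CrM Vu Vu) (cu a))) => x Ax /=.
rewrite /partial [RHS]deriveV; [|exact: u0|exact/diff_derivable/du].
by rewrite scaleNr -[_ *: _]/(_ * _) expr2 invfM.
Qed.

Lemma Cr_det k m (G : 'rV[R]_n -> 'M[R]_m) :
  (forall i j, Cr k A (fun x => G x i j)) -> Cr k A (fun x => \det (G x)).
Proof.
move=> CG; apply: Cr_sum => s; apply: CrM; first exact: Cr_cst.
by apply: Cr_prod => i; exact: CG.
Qed.

Lemma Cr_invmx k m (G : 'rV[R]_n -> 'M[R]_m) :
  (forall x, A x -> G x \in unitmx) -> (forall i j, Cr k A (fun x => G x i j)) ->
  forall i j, Cr k A (fun x => invmx (G x) i j).
Proof.
move=> uG CG i j.
have C1 : Cr k A (fun x => (\det (G x))^-1).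
  apply: CrV; last exact: Cr_det.
  by move=> x /uG; rewrite unitmxE unitfE.
have C2 : Cr k A (fun x => cofactor (G x) j i).
  apply: CrM; first exact: Cr_cst.
  by apply: Cr_det => a b; apply: (eq_Cr oA) (CG (lift j a) (lift i b)) => x _; rewrite !mxE.
by apply: (eq_Cr oA) (CrM C1 C2) => x Ax; rewrite /invmx uG // !mxE.
Qed.

(** One order of regularity is given away: the base case obtains the continuity of [f] from the
    differentiability of its coordinates. For smooth functions this costs nothing. *)
Lemma Cr_comp k m (B : set 'rV[R]_m) (f : 'rV[R]_n -> 'rV[R]_m) (w : 'rV[R]_m -> R) :
  (forall x, A x -> B (f x)) -> (forall r, Cr k A (fun x => f x 0 r)) -> Cr k B w ->
  (k != 0)%N -> Cr k.-1 A (w \o f).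
Proof.
move=> fAB; case: k => // k + + _ /=; elim: k w => [|k IH] w Cf Cw.
  move=> x Ax; apply: continuous_comp; last exact: Cr_continuous Cw (fAB _ Ax).
  by apply/differentiable_continuous/differentiable_row => r; exact: (Cf r).1.
have df x : A x -> differentiable f x.
  by move=> Ax; apply: differentiable_row => r; exact: (Cf r).1.
have dw x : A x -> differentiable w (f x) by move=> /fAB; exact: Cw.1.
split=> [x Ax|a]; first by apply: differentiable_comp; [exact: df|exact: dw].
have C r : Cr k A ((partial a (fun z => f z 0 r)) \* (partial r w \o f)).
  apply: CrM; first by apply: Cr_pred; exact: (Cf r).2.
  by apply: IH; [move=> r'; exact: Cr_pred|exact: Cw.2].
apply: (eq_Cr oA) (Cr_sum C) => x Ax /=.
by rewrite partial_comp //; [exact: df|exact: dw].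
Qed.

Lemma smooth_on_Cr k p q (F : 'rV[R]_n -> 'M[R]_(p, q)) i j :
  smooth_on A F -> Cr k A (fun x => F x i j).
Proof.
move=> /(_ k); elim: k F => [|k IH] F /=.
  move=> cF x Ax; apply: (@continuous_comp _ _ _ F (fun M : 'M[R]_(p, q) => M i j)).
    exact: cF.
  exact: coord_continuous.
move=> [dF CF]; split=> [x Ax|a].
  by apply: (@differentiable_comp _ _ _ _ F (fun M : 'M[R]_(p, q) => M i j));
    [exact: dF|exact: differentiable_coord].
apply: (eq_Cr oA) (IH _ (CF (delta_mx 0 a))) => x Ax.
by rewrite derive_mx ?mxE //; exact/diff_derivable/dF.
Qed.

End OpenSet.

End Cr.

(** * Symmetry of second derivatives *)

Section Schwarz.
Context {R : realType} {n : nat}.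
Implicit Types (u : 'rV[R]_n -> R) (x v w : 'rV[R]_n) (s t h : R).

Lemma is_derive_line u y v (s : R) : differentiable u (y + s *: v) ->
  is_derive s 1 (fun s : R => u (y + s *: v)) ('D_v u (y + s *: v)).
Proof.
move=> du; pose l := fun s : R => y + s *: v.
have dl : is_diff s l (fun h => h *: v).
  apply: is_diff_eq (is_diffD _ _) _.
  by apply/funext => h /=; rewrite fctE add0r.
have dls : differentiable l s by case: dl.
have dul : differentiable (u \o l) s by exact: differentiable_comp.
apply: DeriveDef; first exact: diff_derivable.
rewrite -[LHS]/('D_1 (u \o l) s) deriveE // diff_comp //.
by rewrite /= diff_val scale1r deriveE.
Qed.

Lemma MVT_line u y v (h : R) : 0 < h ->
  (forall s, 0 <= s <= h -> differentiable u (y + s *: v)) ->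
  exists2 s, 0 < s < h & u (y + h *: v) - u y = h * 'D_v u (y + s *: v).
Proof.
move=> h0 du.
have [s||s] := @MVT R (fun s => u (y + s *: v)) (fun s => 'D_v u (y + s *: v)) 0 h h0.
- by rewrite in_itv /= => /andP[s0 sh]; apply: is_derive_line; apply: du; rewrite !ltW.
- apply: derivable_within_continuous => s; rewrite in_itv /= => sh.
  by have := is_derive_line (du s sh); case.
- by rewrite in_itv /= => sh; rewrite scale0r addr0 subr0 mulrC => ?; exists s.
Qed.

Lemma differentiable_translate u x v : differentiable u (x + v) ->
  differentiable (fun z => u (z + v)) x.
Proof.
by move=> du; apply: (@differentiable_comp _ _ _ _ (fun z => z + v) u).
Qed.

Lemma second_difference u x v w (h : R) : 0 < h ->
  (forall s t : R, 0 <= s <= h -> 0 <= t <= h ->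
    differentiable u (x + s *: v + t *: w) /\
    differentiable ('D_v u) (x + s *: v + t *: w)) ->
  exists s t, [/\ 0 <= s <= h, 0 <= t <= h &
    u (x + h *: v + h *: w) - u (x + h *: v) - u (x + h *: w) + u x =
    h * (h * 'D_w ('D_v u) (x + s *: v + t *: w))].
Proof.
move=> h0 du.
have hh : 0 <= h <= h by rewrite lexx ltW.
have hz : (0 : R) <= 0 <= h by rewrite lexx ltW.
pose d := (fun z => u (z + h *: w)) \- u.
have du0 s : 0 <= s <= h -> differentiable u (x + s *: v).
  by move=> hs; have := (du s 0 hs hz).1; rewrite scale0r addr0.
have duh s : 0 <= s <= h -> differentiable (fun z => u (z + h *: w)) (x + s *: v).
  by move=> hs; apply: differentiable_translate; exact: (du _ _ hs hh).1.
have dd s : 0 <= s <= h -> differentiable d (x + s *: v).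
  by move=> hs; apply: differentiableB; [exact: duh|exact: du0].
have [s /andP[s0 sh] Ds] := MVT_line h0 dd.
have hs : 0 <= s <= h by rewrite !ltW.
have [t /andP[t0 th] Dt] := MVT_line h0 (fun t ht => (du s t hs ht).2).
exists s, t; split => //; first by rewrite !ltW.
rewrite -[X in _ * X]Dt.
transitivity (d (x + h *: v) - d x); first by rewrite /d /=; ring.
have D1 : 'D_v d (x + s *: v) = 'D_v (fun z => u (z + h *: w)) (x + s *: v) - 'D_v u (x + s *: v).
  by apply: deriveB; [exact: diff_derivable (duh _ hs)|exact: diff_derivable (du0 _ hs)].
have D2 : 'D_v (fun z => u (z + h *: w)) (x + s *: v) = 'D_v u (x + s *: v + h *: w).
  rewrite /derive; set d1 := (fun _ : R => _); set d2 := (fun _ : R => _).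
  suff -> : d1 = d2 by [].
  by apply/funext => k; rewrite /d1 /d2 /= !addrA.
by rewrite Ds D1 D2.
Qed.

Lemma ler_dist_half (c1 c2 c3 e : R) : `|c3 - c1| < e / 2 -> `|c2 - c1| < e / 2 ->
  `|c2 - c3| <= e.
Proof.
move=> N1 N2; rewrite (splitr e) -(subrKA c1) (le_trans (ler_normD _ _)) // lerD // ltW //.
by rewrite distrC.
Qed.

Lemma partial_commute (A : set 'rV[R]_n) u x a b : open A -> A x -> Cr 2 A u ->
  partial a (partial b u) x = partial b (partial a u) x.
Proof.
move=> oA Ax Cu; have [du C1] := Cu.
pose va : 'rV[R]_n := delta_mx 0 a; pose vb : 'rV[R]_n := delta_mx 0 b.
apply/eqP; rewrite -subr_eq0 -normr_le0; apply/ler_addgt0Pr => e e0; rewrite add0r.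
have e2 : 0 < e / 2 by rewrite divr_gt0.
have cab : {for x, continuous (partial a (partial b u))}.
  exact: (@Cr_continuous _ _ 0 A _ _ ((C1 b).2 a) Ax).
have cba : {for x, continuous (partial b (partial a u))}.
  exact: (@Cr_continuous _ _ 0 A _ _ ((C1 a).2 b) Ax).
have /cvgrPdist_lt /(_ _ e2) nab := cab.
have /cvgrPdist_lt /(_ _ e2) nba := cba.
have nA : \forall z \near x, A z by exact: open_nbhs_nbhs.
have [r /= r0 rP] := (nbhs_ballP _ _).1 (filterI nA (filterI nab nba)).
(* The points of the parallelogram with sides [h *: va] and [h *: vb] lie within [h * m = r / 2] of
   [x]; the summand 1 only makes [m] positive. *)
pose m := `|va| + `|vb| + 1.
have m0 : 0 < m by rewrite ltr_wpDl // addr_ge0.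
pose h := r / m / 2.
have h0 : 0 < h by rewrite !divr_gt0.
have ballP s t : 0 <= s <= h -> 0 <= t <= h -> ball x r (x + s *: va + t *: vb).
  move=> /andP[s0 sh] /andP[t0 th]; rewrite -ball_normE /= -addrA opprD addNKr normrN.
  apply: le_lt_trans (ler_normD _ _) _; rewrite !normrZ !ger0_norm //.
  apply: (@le_lt_trans _ _ (h * m)).
    rewrite /m !mulrDr mulr1 -[leLHS]addr0 lerD // ?lerD ?ler_wpM2r //; exact: ltW.
  by rewrite /h mulrAC divfK ?gt_eqF // ltr_pdivrMr // ltr_pMr // ltr1n.
have ballP' s t : 0 <= s <= h -> 0 <= t <= h -> ball x r (x + s *: vb + t *: va).
  by move=> hs ht; rewrite addrAC; exact: ballP.
have [y1 By1 D1] : exists2 y, ball x r y &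
    u (x + h *: va + h *: vb) - u (x + h *: va) - u (x + h *: vb) + u x =
    h * (h * partial b (partial a u) y).
  have [|s [t [hs ht Dst]]] := @second_difference u x va vb h h0.
    move=> s t hs ht; have [Az _] := rP _ (ballP _ _ hs ht).
    by split; [exact: du|exact: (C1 a).1].
  by exists (x + s *: va + t *: vb); first exact: ballP.
have [y2 By2 D2] : exists2 y, ball x r y &
    u (x + h *: va + h *: vb) - u (x + h *: va) - u (x + h *: vb) + u x =
    h * (h * partial a (partial b u) y).
  have [|s [t [hs ht Dst]]] := @second_difference u x vb va h h0.
    move=> s t hs ht; have [Az _] := rP _ (ballP' _ _ hs ht).
    by split; [exact: du|exact: (C1 b).1].
  exists (x + s *: vb + t *: va); first exact: ballP'.
  by rewrite -Dst (addrAC x) -!addrA; congr (_ + _); rewrite addrCA.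
(* Both orders of differentiation compute the same second difference, up to the factor [h * h], at
   points of the ball where each derivative is within [e / 2] of its value at [x]. *)
have {D1 D2} E : partial b (partial a u) y1 = partial a (partial b u) y2.
  exact: (mulfI (lt0r_neq0 h0) (mulfI (lt0r_neq0 h0) (etrans (esym D1) D2))).
have [_ [+ _]] := rP _ By2; have [_ [_ +]] := rP _ By1.
rewrite /= E; exact: ler_dist_half.
Qed.

End Schwarz.

(** * Calculus modulo the difference of two jets *)

Section Dominated.
Context {R : realType} {n : nat} (A : set 'rV[R]_n) (p : 'rV[R]_n).
Hypotheses (oA : open A) (Ap : A p).
Variable e : nat -> 'rV[R]_n -> R.
Hypothesis e_mono : forall k x, e k x <= e k.+1 x.
Implicit Types (u v w : 'rV[R]_n -> R).

Definition bigO_at k w := exists2 C, 0 <= C & \forall x \near p, `|w x| <= C * e k x.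

Lemma near_open : \forall x \near p, A x.
Proof. exact: open_nbhs_nbhs. Qed.

Lemma eq_bigO_at k v w : (forall x, A x -> v x = w x) -> bigO_at k v -> bigO_at k w.
Proof.
move=> vw [C C0 H]; exists C => //; near=> x.
rewrite -vw; first by near: x.
by near: x; exact: near_open.
Unshelve. all: by end_near. Qed.

Lemma bigO_atS k w : bigO_at k w -> bigO_at k.+1 w.
Proof.
move=> [C C0 H]; exists C => //; near=> x; apply: (@le_trans _ _ (C * e k x)).
  by near: x.
exact: ler_wpM2l.
Unshelve. all: by end_near. Qed.

Lemma bigO_at0 k : bigO_at k (cst 0).
Proof. by exists 0 => //; near=> x; rewrite normr0 mul0r.
Unshelve. all: by end_near. Qed.

Lemma bigO_atD k v w : bigO_at k v -> bigO_at k w -> bigO_at k (v \+ w).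
Proof.
move=> [C C0 H] [D D0 I]; exists (C + D); first exact: addr_ge0.
near=> x; apply: le_trans (ler_normD _ _) _; rewrite mulrDl lerD //; near: x.
  exact: H.
exact: I.
Unshelve. all: by end_near. Qed.

Lemma bigO_atM k v w : {for p, continuous v} -> bigO_at k w -> bigO_at k (v \* w).
Proof.
move=> cv [C C0 H]; exists ((`|v p| + 1) * C); first by rewrite mulr_ge0 // addr_ge0.
have /cvgrPdist_lt /(_ _ ltr01) nv := cv.
near=> x; rewrite normrM -mulrA ler_pM //; last by near: x.
rewrite -lerBlDl (le_trans (lerB_dist _ _)) // distrC ltW //.
by near: x.
Unshelve. all: by end_near. Qed.

(* In the application [e k] is the size of the [k]-jet of [f1 - f2]; then
   [jdom m k w] says that for [i <= m] the derivatives of order [i] of [w] are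
   [O(e (k + i))] at [p]. *)
Fixpoint jdom m k w : Prop :=
  match m with
  | 0 => Cr 0 A w /\ bigO_at k w
  | m'.+1 => [/\ forall x, A x -> differentiable w x, bigO_at k w &
                 forall a, jdom m' k.+1 (partial a w)]
  end.

Lemma jdom_Cr m k w : jdom m k w -> Cr m A w.
Proof.
elim: m k w => [|m IH] k w; first by move=> [].
by move=> [dw _ pw]; split => // a; exact: IH (pw a).
Qed.

Lemma jdom_bigO m k w : jdom m k w -> bigO_at k w.
Proof. by case: m => [|m] /= []. Qed.

Lemma jdom_partial m k w a : jdom m.+1 k w -> jdom m k.+1 (partial a w).
Proof. by move=> [_ _]; apply. Qed.

Lemma eq_jdom m k v w : (forall x, A x -> v x = w x) -> jdom m k v -> jdom m k w.
Proof.
elim: m k v w => [|m IH] k v w vw.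
  by move=> [Cv Ov]; split; [exact: (eq_Cr oA vw Cv)|exact: eq_bigO_at vw Ov].
move=> [dv Ov pv]; split; [|exact: eq_bigO_at vw Ov|].
  by move=> x Ax; exact: near_eq_differentiable (near_eq_on oA vw Ax) (dv x Ax).
by move=> a; apply: IH (pv a) => x Ax; exact: (eq_partial _ oA vw Ax).
Qed.

Lemma jdom_pred m k w : jdom m.+1 k w -> jdom m k w.
Proof.
move=> Ew; move: (Cr_pred (jdom_Cr Ew)); elim: m k w Ew => [|m IH] k w /=.
  by move=> [_ Ow _] Cw; split.
move=> [dw Ow pw] [_ Cw]; split => // a; apply: IH; last exact: Cw.
exact: pw.
Qed.

Lemma jdomS m k w : jdom m k w -> jdom m k.+1 w.
Proof.
elim: m k w => [|m IH] k w; first by move=> [? ?]; split => //; exact: bigO_atS.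
by move=> [? ? pw]; split => //; [exact: bigO_atS|move=> a; exact: IH (pw a)].
Qed.

Lemma jdom0 m k : jdom m k (cst 0).
Proof.
elim: m k => [|m IH] k.
  by split; [move=> x _; exact: cst_continuous|exact: bigO_at0].
split; [by move=> x _; exact: differentiable_cst|exact: bigO_at0|].
move=> a; apply: eq_jdom (IH k.+1) => x _; rewrite /partial; apply/esym; exact: derive_cst.
Qed.

Lemma jdomD m k v w : jdom m k v -> jdom m k w -> jdom m k (v \+ w).
Proof.
elim: m k v w => [|m IH] k v w.
  by move=> [Cv Ov] [Cw Ow]; split; [exact: (CrD oA Cv Cw)|exact: bigO_atD].
move=> [dv Ov pv] [dw Ow pw]; split.
- by move=> x Ax; apply: differentiableD; [exact: dv|exact: dw].
- exact: bigO_atD.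
- move=> a; apply: eq_jdom (IH _ _ _ (pv a) (pw a)) => x Ax.
  by rewrite partialD //; [exact: dv|exact: dw].
Qed.

(** In the Leibniz rule, [v w'] has level [k.+1]; the other term, [v' w], has the better level [k],
    and [e_mono] weakens it to [k.+1]. *)
Lemma jdomM m k v w : Cr m A v -> jdom m k w -> jdom m k (v \* w).
Proof.
elim: m k v w => [|m IH] k v w.
  move=> Cv [Cw Ow]; split; first exact: (CrM oA Cv Cw).
  by apply: bigO_atM => //; exact: Cr_continuous Cv Ap.
move=> Cv Ew; have [dv pv] := Cv; have [dw Ow pw] := Ew; split.
- by move=> x Ax; apply: differentiableM; [exact: dv|exact: dw].
- by apply: bigO_atM => //; exact: Cr_continuous Cv Ap.
- move=> a; have E1 := IH _ _ _ (pv a) (jdomS (jdom_pred Ew)).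
  have E2 := IH _ _ _ (Cr_pred Cv) (pw a).
  apply: eq_jdom (jdomD E1 E2) => x Ax.
  by rewrite partialM //; [exact: dv|exact: dw].
Qed.

Lemma jdomZ m k (c : R) w : jdom m k w -> jdom m k (fun x => c * w x).
Proof. by move=> Ew; apply: jdomM Ew; exact: Cr_cst. Qed.

Lemma jdomB m k v w : jdom m k v -> jdom m k w -> jdom m k (v \- w).
Proof.
move=> Ev Ew; apply: eq_jdom (jdomD Ev (jdomZ (-1) Ew)) => x _ /=.
by rewrite mulN1r.
Qed.

Lemma jdom_sum m k (I : finType) (w : I -> 'rV[R]_n -> R) :
  (forall i, jdom m k (w i)) -> jdom m k (fun x => \sum_i w i x).
Proof.
move=> Ew; rewrite (_ : (fun _ => _) = \sum_i w i); last first.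
  by apply/funext => z; rewrite fct_sumE.
by elim/big_ind: _ => //; [exact: jdom0|move=> *; exact: jdomD].
Qed.

(** This is u1 v1 - u2 v2 = u1 (v1 - v2) + v2 (u1 - u2). *)
Lemma jdom_BM m k u1 u2 v1 v2 : Cr m A u1 -> Cr m A v2 ->
  jdom m k (u1 \- u2) -> jdom m k (v1 \- v2) ->
  jdom m k (fun x => u1 x * v1 x - u2 x * v2 x).
Proof.
move=> Cu Cv Eu Ev; apply: eq_jdom (jdomD (jdomM Cu Ev) (jdomM Cv Eu)) => x _ /=.
ring.
Qed.

Lemma jdom_Bpartial m k u1 u2 a : Cr 1 A u1 -> Cr 1 A u2 -> jdom m.+1 k (u1 \- u2) ->
  jdom m k.+1 (partial a u1 \- partial a u2).
Proof.
move=> C1 C2 /(@jdom_partial _ _ _ a); apply: eq_jdom => x Ax.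
by rewrite partialB //; [exact: C1.1|exact: C2.1].
Qed.

End Dominated.

(** * Composition of two nearby maps with a fixed smooth function *)

Section Composition.
Context {R : realType} {n : nat}.

Definition smooth_fun (A : set 'rV[R]_n) u := forall k, Cr k A u.

Lemma smooth_fun_partial (A : set 'rV[R]_n) u a : smooth_fun A u -> smooth_fun A (partial a u).
Proof. by move=> su k; exact: (su k.+1).2. Qed.

Lemma smooth_fun_diff (A : set 'rV[R]_n) u x : smooth_fun A u -> A x -> differentiable u x.
Proof. by move=> /(_ 1%N) [du _]; exact: du. Qed.

(** Mean value theorem on a segment of a ball where each partial derivative exceeds its value at
    [y0] by at most 1 in size; [C] adds these bounds so that one constant serves all coordinates. *)
Lemma locally_lipschitz (B : set 'rV[R]_n) (h : 'rV[R]_n -> R) y0 :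
  open B -> B y0 -> Cr 1 B h ->
  exists2 C, 0 <= C & exists2 r, 0 < r & forall y z, ball y0 r y -> ball y0 r z ->
    `|h y - h z| <= C * \sum_l `|y 0 l - z 0 l|.
Proof.
move=> oB By0 [dh ch].
pose C := \sum_a (`|partial a h y0| + 1).
have C0 : 0 <= C by apply: sumr_ge0 => a _; exact: addr_ge0.
exists C => //.
have nB : \forall z \near y0, B z by exact: open_nbhs_nbhs.
have nCa a : \forall z \near y0, `|partial a h z| <= `|partial a h y0| + 1.
  have /cvgrPdist_lt /(_ _ ltr01) H := ch a _ By0.
  near=> z; rewrite -lerBlDl (le_trans (lerB_dist _ _)) // distrC ltW //.
  by near: z.
have nC := @filter_forall 'rV[R]_n 'I_n
  (fun a z => `|partial a h z| <= `|partial a h y0| + 1) (nbhs y0) (nbhs_filter y0) nCa.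
have [r /= r0 rP] := (nbhs_ballP _ _).1 (filterI nB nC).
exists r => // y z yb zb.
pose v := y - z.
have seg s : 0 <= s <= 1 -> ball y0 r (z + s *: v).
  move=> /andP[s0 s1]; move: yb zb; rewrite -!ball_normE /= /v => yb zb.
  have -> : y0 - (z + s *: (y - z)) = s *: (y0 - y) + (1 - s) *: (y0 - z).
    by apply/rowP => i; rewrite !mxE; ring.
  rewrite (le_lt_trans (ler_normD _ _)) // !normrZ !ger0_norm ?subr_ge0 //.
  (* The weight [s] on [y0 - y] gives the strict inequality when it is positive; at [s = 0] only
     [y0 - z] remains. *)
  have [->|sn0] := eqVneq s 0; first by rewrite mul0r add0r subr0 mul1r.
  have sp : 0 < s by rewrite lt_neqAle eq_sym sn0.
  move: (`|y0 - y|) (`|y0 - z|) yb zb => a b ar br.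
  have H1 : 0 < s * (r - a) by rewrite mulr_gt0 // subr_gt0.
  have H2 : 0 <= (1 - s) * (r - b) by rewrite mulr_ge0 // subr_ge0 // ltW.
  lra.
have [s /andP[s0 s1]] := MVT_line ltr01 (fun s hs => dh _ (rP _ (seg s hs)).1).
have hs : 0 <= s <= 1 by rewrite !ltW.
have [Bs Cs] := rP _ (seg s hs).
rewrite scale1r mul1r /v subrKC => ->.
rewrite derive_partial; last exact: dh.
rewrite (le_trans (ler_norm_sum _ _ _)) // mulr_sumr ler_sum // => a _.
rewrite normrM mulrC !mxE ler_wpM2r // (le_trans (Cs a)) //.
rewrite /C (bigD1 a) //= lerDl; apply: sumr_ge0 => b _; exact: addr_ge0.
Unshelve. all: by end_near. Qed.

Variables (A : set 'rV[R]_n) (p : 'rV[R]_n).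
Hypotheses (oA : open A) (Ap : A p).
Variable e : nat -> 'rV[R]_n -> R.
Hypothesis e_mono : forall k x, e k x <= e k.+1 x.

Lemma bigO_at_le k v w : (\forall x \near p, `|w x| <= `|v x|) ->
  bigO_at p e k v -> bigO_at p e k w.
Proof.
move=> wv [C C0 H]; exists C => //; near=> x.
apply: (@le_trans _ _ `|v x|); first by near: x; exact: wv.
by near: x; exact: H.
Unshelve. all: by end_near. Qed.

Lemma bigO_at_norm_sum k (I : finType) (w : I -> 'rV[R]_n -> R) :
  (forall i, bigO_at p e k (w i)) -> bigO_at p e k (fun x => \sum_i `|w i x|).
Proof.
move=> Ow; rewrite (_ : (fun _ => _) = \sum_i (fun x => `|w i x|)); last first.
  by apply/funext => z; rewrite fct_sumE.
elim/big_ind: _ => [|u v Ou Ov|i _]; first exact: bigO_at0.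
  exact: bigO_atD.
by apply: bigO_at_le (Ow i); near=> x; rewrite normr_id.
Unshelve. all: by end_near. Qed.

Variables (B : set 'rV[R]_n) (f1 f2 : 'rV[R]_n -> 'rV[R]_n).
Hypotheses (oB : open B) (fB1 : forall x, A x -> B (f1 x)) (fB2 : forall x, A x -> B (f2 x)).
Hypotheses (sf1 : forall r, smooth_fun A (fun x => f1 x 0 r))
           (sf2 : forall r, smooth_fun A (fun x => f2 x 0 r)).
Hypothesis f12p : f1 p = f2 p.

(** Order 0 is the local Lipschitz bound for [h]; [f12p] places both maps in the same small ball.
    For higher orders the chain rule gives products of a derivative of [f], of level 1, with
    [partial r h \o f], to which the induction applies because it runs over all smooth [h]. *)
Lemma jdom_comp m h : smooth_fun B h ->
  (forall r, jdom A p e m 0 ((fun x => f1 x 0 r) \- (fun x => f2 x 0 r))) ->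
  jdom A p e m 0 ((h \o f1) \- (h \o f2)).
Proof.
have Chf (f : 'rV[R]_n -> 'rV[R]_n) k h' : (forall x, A x -> B (f x)) ->
    (forall r, smooth_fun A (fun x => f x 0 r)) -> smooth_fun B h' -> Cr k A (h' \o f).
  by move=> fB sf sh; apply: (Cr_comp oA fB (k := k.+1)) => [r||//]; [exact: sf|exact: sh].
have Oh h' : smooth_fun B h' ->
    (forall r, bigO_at p e 0 ((fun x => f1 x 0 r) \- (fun x => f2 x 0 r))) ->
    bigO_at p e 0 ((h' \o f1) \- (h' \o f2)).
  move=> sh Od.
  have [C C0 [r r0 H]] := locally_lipschitz oB (fB1 Ap) (sh 1%N).
  have O1 := bigO_at_norm_sum Od.
  have O2 : bigO_at p e 0 ((cst C) \* (fun x => \sum_l `|((fun x => f1 x 0 l) \- (fun x => f2 x 0 l)) x|)).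
    by apply: bigO_atM => //; exact: cst_continuous.
  apply: bigO_at_le O2.
  have cf (f : 'rV[R]_n -> 'rV[R]_n) : (forall r, smooth_fun A (fun x => f x 0 r)) ->
     f1 p = f p -> \forall x \near p, ball (f1 p) r (f x).
    move=> sf ->; have cf : {for p, continuous f}.
      apply/differentiable_continuous/differentiable_row => l.
      exact: smooth_fun_diff (sf l) Ap.
    by apply: cf; exact: nbhsx_ballx.
  have n1 := cf _ sf1 erefl; have n2 := cf _ sf2 f12p.
  near=> x; rewrite /= [leRHS]ger0_norm ?mulr_ge0 ?sumr_ge0 //.
    by apply: H; near: x; [exact: n1|exact: n2].
elim: m h => [|m IH] h sh Ed.
  split; first by apply: CrB => //; exact: Chf.
  by apply: Oh => // r; exact: jdom_bigO (Ed r).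
have Chd f : (forall x, A x -> B (f x)) ->
    (forall r, smooth_fun A (fun x => f x 0 r)) -> 
    forall x, A x -> differentiable (h \o f) x.
  by move=> fB sf x Ax; exact: (Chf f 1%N h fB sf sh).1.
split.
- by move=> x Ax; apply: differentiableB; exact: Chd.
- by apply: Oh => // r; exact: jdom_bigO (Ed r).
move=> a.
pose t r (f : 'rV[R]_n -> 'rV[R]_n) x := partial a (fun z => f z 0 r) x * (partial r h \o f) x.
have Et r : jdom A p e m 1 (fun x => t r f1 x - t r f2 x).
  apply: jdom_BM => //.
  - exact: (sf1 r m.+1).2.
  - by apply: Chf => //; exact: smooth_fun_partial.
  - by apply: jdom_Bpartial (Ed r) => //; [exact: sf1|exact: sf2].
  - apply: jdomS => //; apply: IH; first exact: smooth_fun_partial.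
    by move=> r'; exact: jdom_pred (Ed r').
apply: (eq_jdom oA Ap) (jdom_sum oA Ap Et) => x Ax.
rewrite partialB; [|exact: Chd|exact: Chd].
have pc f : (forall x, A x -> B (f x)) -> (forall r, smooth_fun A (fun x => f x 0 r)) ->
    partial a (h \o f) x = \sum_r t r f x.
  move=> fB sf; rewrite partial_comp //.
    by apply: differentiable_row => r; exact: smooth_fun_diff (sf r) Ax.
  by apply: smooth_fun_diff sh _; exact: fB.
by rewrite !pc // sumrB.
Unshelve. all: by end_near. Qed.

End Composition.

(** * The size of a jet *)

Section Jet.
Context {R : realType} {n : nat}.
Implicit Types (u v w : 'rV[R]_n -> R).

Fixpoint jet k u (x : 'rV[R]_n) : R :=
  match k with
  | 0 => `|u x|
  | k'.+1 => `|u x| + \sum_a jet k' (partial a u) x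
  end.

Lemma jet_ge0 k u x : 0 <= jet k u x.
Proof.
elim: k u => [|k IH] u /=; first exact: normr_ge0.
by rewrite addr_ge0 // sumr_ge0.
Qed.

Lemma jetS k u x : jet k u x <= jet k.+1 u x.
Proof.
elim: k u => [|k IH] u /=.
  by rewrite lerDl sumr_ge0.
by rewrite lerD2l ler_sum // => a _; exact: IH.
Qed.

Lemma jet_partial k u a x : jet k (partial a u) x <= jet k.+1 u x.
Proof.
rewrite /= (bigD1 a) //= addrCA lerDl addr_ge0 // sumr_ge0 // => b _; exact: jet_ge0.
Qed.

(** Starting point of the calculus: a function is dominated by its own jets, with constant 1. *)
Lemma jdom_jet (A : set 'rV[R]_n) p (e : nat -> 'rV[R]_n -> R) m k w : smooth_fun A w ->
  (forall j x, jet j w x <= e (k + j)%N x) -> jdom A p e m k w.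
Proof.
elim: m k w => [|m IH] k w sw jw.
  split; first exact: sw.
  by exists 1 => //; near=> x; rewrite mul1r -[k]addn0 (le_trans _ (jw 0%N x)).
split.
- by move=> x; exact: smooth_fun_diff.
- by exists 1 => //; near=> x; rewrite mul1r -[k]addn0 (le_trans _ (jw 0%N x)).
- move=> a; apply: IH; first exact: smooth_fun_partial.
  by move=> j x; rewrite addSnnS (le_trans _ (jw j.+1 x)) // jet_partial.
Unshelve. all: by end_near. Qed.

End Jet.

(** * The third derivative of a conformal map *)

Section SmoothClosure.
Context {R : realType} {n : nat} (A : set 'rV[R]_n).
Hypothesis oA : open A.
Implicit Types u v w : 'rV[R]_n -> R.

Lemma smooth_funD u w : smooth_fun A u -> smooth_fun A w -> smooth_fun A (u \+ w).
Proof. by move=> su sw k; apply: CrD. Qed.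

Lemma smooth_funB u w : smooth_fun A u -> smooth_fun A w -> smooth_fun A (u \- w).
Proof. by move=> su sw k; apply: CrB. Qed.

Lemma smooth_funM u w : smooth_fun A u -> smooth_fun A w -> smooth_fun A (u \* w).
Proof. by move=> su sw k; apply: CrM. Qed.

Lemma smooth_fun_sum (I : finType) (u : I -> 'rV[R]_n -> R) :
  (forall i, smooth_fun A (u i)) -> smooth_fun A (fun x => \sum_i u i x).
Proof. by move=> su k; apply: Cr_sum => // i; exact: su. Qed.

Lemma smooth_funV u : (forall x, A x -> u x != 0) -> smooth_fun A u ->
  smooth_fun A (fun x => (u x)^-1).
Proof. by move=> u0 su k; apply: CrV. Qed.

Lemma smooth_fun_comp m (B : set 'rV[R]_m) (f : 'rV[R]_n -> 'rV[R]_m) (w : 'rV[R]_m -> R) :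
  (forall x, A x -> B (f x)) -> (forall r, smooth_fun A (fun x => f x 0 r)) ->
  (forall k, Cr k B w) -> smooth_fun A (w \o f).
Proof.
move=> fB sf sw k; apply: (Cr_comp oA fB (k := k.+1)) => //.
by move=> r; exact: sf.
Qed.

Lemma partial_dot m (u v : 'I_m -> 'rV[R]_n -> R) k x : A x ->
  (forall i, smooth_fun A (u i)) -> (forall i, smooth_fun A (v i)) ->
  partial k (fun x => \sum_i u i x * v i x) x =
  \sum_i partial k (u i) x * v i x + \sum_i u i x * partial k (v i) x.
Proof.
move=> Ax su sv.
rewrite (@partial_sum _ _ _ (fun i => u i \* v i)); last first.
  by move=> i; apply: smooth_fun_diff Ax; exact: smooth_funM.
rewrite -big_split /=; apply: eq_bigr => i _.
by rewrite partialM //; [exact: smooth_fun_diff (su i) Ax|exact: smooth_fun_diff (sv i) Ax].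
Qed.

Lemma partial_cst (c : R) k x : partial k (cst c : 'rV[R]_n -> R) x = 0.
Proof. exact: derive_cst. Qed.

End SmoothClosure.

(* Unification otherwise unfolds [partial] down to limits when comparing two
   different partial derivatives. *)
Local Opaque partial.

(** The Koszul formula on plain scalars: the sum of the first two equations minus the third leaves
    [2 * t1] by the three symmetries. *)
Lemma koszul_identity {R : realFieldType} (t1 t2 t3 t4 t5 t6 s1 s2 s3 r1 r2 r3 : R) :
  t1 + t2 = s1 + r1 -> t3 + t4 = s2 + r2 -> t5 + t6 = s3 + r3 ->
  t1 = t3 -> t4 = t5 -> t2 = t6 -> 2 * t1 = s1 + s2 - s3 + r1 + r2 - r3.
Proof. lra. Qed.

Lemma koszul_remainder {R : realFieldType} (t r s1 s2 s3 s4 s5 s6 r1 r2 r3 : R) :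
  s1 + s2 + (s3 + s4) - (s5 + s6) + r1 + r2 - r3 = t + r ->
  t = s1 + s3 - s5 + (s2 + s4 - s6 + r1 + r2 - r3 - r).
Proof. lra. Qed.

Section ConformalJet.
Context {R : realType} {n : nat}.
Variables (A B : set 'rV[R]_n).
Hypotheses (oA : open A) (oB : open B).
Variables (g h : 'I_n -> 'I_n -> 'rV[R]_n -> R).
Hypotheses (sg : forall a b, smooth_fun A (g a b)) (sh : forall a b, smooth_fun B (h a b)).
Hypothesis hC : forall a b x, B x -> h a b x = h b a x.
Variables a0 b0 : 'I_n.
Hypothesis g0 : forall x, A x -> g a0 b0 x != 0.

Section OneMap.
Variable f : 'rV[R]_n -> 'rV[R]_n.
Hypothesis fB : forall x, A x -> B (f x).
Hypothesis sf : forall r, smooth_fun A (fun x => f x 0 r).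
Variable c : 'rV[R]_n -> R.
Local Notation D := partial.
Local Notation F l := (fun x : 'rV[R]_n => f x 0 l).

Hypothesis conf : forall a b x, A x ->
  \sum_l \sum_m D a (F l) x * h l m (f x) * D b (F m) x = c x * g a b x.

(* [accel a k b] is [h(d_k d_a f, d_b f)]; [rem1] and [rem2] collect the terms
   that depend only on the 1-jet, respectively the 2-jet, of [f]. *)
Definition pull l m := h l m \o f.
(** The covector h(., d_b f): contracting it with a vector along [f] gives the inner product with
    d_b f. *)
Definition lowered b l x := \sum_m pull l m x * D b (F m) x.
(** The conformal factor read off from the single component (a0, b0). It equals [c] on [A], but its
    form shows that it is smooth and depends on the 1-jet of [f]. *)
Definition factor x := (\sum_l D a0 (F l) x * lowered b0 l x) * (g a0 b0 x)^-1.
Definition metric_variation a b k x := \sum_l D a (F l) x * (\sum_m D k (pull l m) x * D b (F m) x).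
Definition rem1 a b k x := factor x * D k (g a b) x - metric_variation a b k x.
Definition accel a k b x := \sum_l D k (D a (F l)) x * lowered b l x.
Definition rem2 a k j b x :=
  D k factor x * D j (g a b) x + D a factor x * D j (g k b) x - D b factor x * D j (g a k) x
  + D j (rem1 a b k) x + D j (rem1 k b a) x - D j (rem1 a k b) x
  - 2 * \sum_l D k (D a (F l)) x * D j (lowered b l) x.

Let sDf a l : smooth_fun A (D a (F l)). Proof. exact/smooth_fun_partial/sf. Qed.
Let sDDf k a l : smooth_fun A (D k (D a (F l))). Proof. exact/smooth_fun_partial/sDf. Qed.

Lemma smooth_pull l m : smooth_fun A (pull l m).
Proof. by apply: (smooth_fun_comp oA fB); [exact: sf|exact: sh]. Qed.

Lemma smooth_lowered b l : smooth_fun A (lowered b l).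
Proof.
by apply: smooth_fun_sum => // m; apply: smooth_funM => //; exact: smooth_pull.
Qed.

Lemma smooth_factor : smooth_fun A factor.
Proof.
apply: smooth_funM => //.
  by apply: smooth_fun_sum => // l; apply: smooth_funM => //; exact: smooth_lowered.
by apply: smooth_funV.
Qed.

Lemma smooth_metric_variation a b k : smooth_fun A (metric_variation a b k).
Proof.
apply: smooth_fun_sum => // l; apply: smooth_funM => //; apply: smooth_fun_sum => // m.
by apply: smooth_funM => //; apply: smooth_fun_partial; exact: smooth_pull.
Qed.

Lemma smooth_rem1 a b k : smooth_fun A (rem1 a b k).
Proof.
apply: smooth_funB => //; last exact: smooth_metric_variation.
by apply: smooth_funM => //; [exact: smooth_factor|exact: smooth_fun_partial].
Qed.

Lemma conformal_lowered a b x : A x ->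
  \sum_l D a (F l) x * lowered b l x = c x * g a b x.
Proof.
move=> Ax; rewrite -conf //; apply: eq_bigr => l _; rewrite mulr_sumr.
by apply: eq_bigr => m _; rewrite mulrA.
Qed.

Lemma factorE x : A x -> factor x = c x.
Proof. by move=> Ax; rewrite /factor conformal_lowered // mulfK // g0. Qed.

Lemma pullC l m x : A x -> pull l m x = pull m l x.
Proof. by move=> Ax; rewrite /pull /= hC //; exact: fB. Qed.

(** Derivative of the (a, b) component of the conformal equation along [k]. The derivative falling
    on [h \o f] is of first order in [f] and goes to [rem1]; the one falling on d_b f becomes
    [accel b k a] by the symmetry of [h]. *)
Lemma conformal_diff1 a b k x : A x ->
  accel a k b x + accel b k a x = D k factor x * g a b x + rem1 a b k x.
Proof.
move=> Ax.
have E : D k (fun x => \sum_l D a (F l) x * lowered b l x) x = D k (factor \* g a b) x.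
  by apply: (eq_partial _ oA _ Ax) => y Ay /=; rewrite conformal_lowered // factorE.
rewrite (partial_dot oA) // in E; last by move=> l; exact: smooth_lowered.
rewrite partialM in E; [|exact: smooth_fun_diff smooth_factor Ax|exact: smooth_fun_diff (sg a b) Ax].
rewrite /rem1 addrA -E -/(accel a k b x) -addrA; congr (_ + _).
have Dl l : D k (lowered b l) x =
    \sum_m D k (pull l m) x * D b (F m) x + \sum_m pull l m x * D k (D b (F m)) x.
  by apply: (partial_dot oA) => // m; exact: smooth_pull.
under eq_bigr => l _ do rewrite Dl mulrDr.
rewrite big_split /= -/(metric_variation a b k x) addrAC subrr add0r.
under eq_bigr => l _ do rewrite mulr_sumr.
rewrite exchange_big /=; apply: eq_bigr => m _; rewrite mulr_sumr.
apply: eq_bigr => l _; rewrite (pullC _ _ Ax); ring.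
Qed.

Lemma accelC a k b x : A x -> accel a k b x = accel k a b x.
Proof.
move=> Ax.
have H l : D k (D a (F l)) x = D a (D k (F l)) x := partial_commute k a oA Ax (sf l 2%N).
by apply: eq_bigr => l _; exact: (congr1 ( *%R^~ (lowered b l x)) (H l)).
Qed.

Lemma accelE a k b x : A x -> 2 * accel a k b x =
  D k factor x * g a b x + D a factor x * g k b x - D b factor x * g a k x
  + rem1 a b k x + rem1 k b a x - rem1 a k b x.
Proof.
move=> Ax.
exact: koszul_identity (conformal_diff1 a b k Ax) (conformal_diff1 k b a Ax) (conformal_diff1 a k b Ax)
  (accelC a k b Ax) (accelC b a k Ax) (accelC b k a Ax).
Qed.

(** Derivative of [accelE] along [j]. The second derivatives of [factor] stay outside [rem2] because
    they contain third derivatives of [f]; everything in [rem2] is of order at most two. *)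
Lemma third_derivative a k j b x : A x ->
  2 * (\sum_l D j (D k (D a (F l))) x * lowered b l x) =
  D j (D k factor) x * g a b x + D j (D a factor) x * g k b x - D j (D b factor) x * g a k x
  + rem2 a k j b x.
Proof.
move=> Ax.
pose rhs := (D k factor \* g a b) \+ (D a factor \* g k b) \- (D b factor \* g a k)
  \+ rem1 a b k \+ rem1 k b a \- rem1 a k b.
have sD i : smooth_fun A (D i factor) by apply: smooth_fun_partial; exact: smooth_factor.
have sM i a' b' : smooth_fun A (D i factor \* g a' b') by exact: smooth_funM.
have sr a' b' k' : smooth_fun A (rem1 a' b' k') by exact: smooth_rem1.
have dD i : differentiable (D i factor) x by exact: smooth_fun_diff (sD i) Ax.
have dM i a' b' : differentiable (D i factor \* g a' b') x.
  exact: smooth_fun_diff (sM i a' b') Ax.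
have dr a' b' k' : differentiable (rem1 a' b' k') x by exact: smooth_fun_diff (sr a' b' k') Ax.
have dg a' b' : differentiable (g a' b') x by exact: smooth_fun_diff (sg a' b') Ax.
have sacc : smooth_fun A (accel a k b).
  by apply: smooth_fun_sum => // l; apply: smooth_funM => //; exact: smooth_lowered.
have E : D j (cst 2 \* accel a k b) x = D j rhs x.
  by apply: (eq_partial _ oA _ Ax) => y Ay; exact: accelE.
have E2 : D j rhs x = D j (D k factor) x * g a b x + D k factor x * D j (g a b) x
   + (D j (D a factor) x * g k b x + D a factor x * D j (g k b) x)
   - (D j (D b factor) x * g a k x + D b factor x * D j (g a k) x)
   + D j (rem1 a b k) x + D j (rem1 k b a) x - D j (rem1 a k b) x.
  have d1 : differentiable ((D k factor \* g a b) \+ (D a factor \* g k b)) x by exact: differentiableD.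
  have d2 := differentiableB d1 (dM b a k).
  have d3 := differentiableD d2 (dr a b k).
  have d4 := differentiableD d3 (dr k b a).
  rewrite /rhs partialB; [|exact: d4|exact: dr].
  rewrite partialD; [|exact: d3|exact: dr].
  rewrite partialD; [|exact: d2|exact: dr].
  rewrite partialB; [|exact: d1|exact: dM].
  rewrite partialD; [|exact: dM|exact: dM].
  by rewrite !(partialM _ (dD _) (dg _ _)).
have E3 : D j (cst 2 \* accel a k b) x = 2 * (\sum_l D j (D k (D a (F l))) x * lowered b l x)
    + 2 * (\sum_l D k (D a (F l)) x * D j (lowered b l) x).
  rewrite partialM; [|exact: differentiable_cst|exact: smooth_fun_diff sacc Ax].
  rewrite partial_cst mul0r add0r /cst -mulrDr; congr (_ * _).
  by apply: (partial_dot oA) => // l; exact: smooth_lowered.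
rewrite /rem2; exact: (koszul_remainder (etrans (esym E2) (etrans (esym E) E3))).
Qed.

End OneMap.

End ConformalJet.

(** * Expressions in the jet of a map, modulo the jet of the difference *)

Section Congruence.
Context {R : realType} {n : nat} (A : set 'rV[R]_n) (p : 'rV[R]_n).
Hypotheses (oA : open A) (Ap : A p).
Variable e : nat -> 'rV[R]_n -> R.
Hypothesis e_mono : forall k x, e k x <= e k.+1 x.
Implicit Types (u v w : 'rV[R]_n -> R).

(** Meant for one expression evaluated at two maps, [k] being the number of derivatives of the map
    in it. Requiring the bound for every [m] allows differentiation at will: it consumes one [m] and
    raises [k]. *)
Definition cong k u1 u2 :=
  [/\ smooth_fun A u1, smooth_fun A u2 & forall m, jdom A p e m k (u1 \- u2)].

Lemma cong_refl k u : smooth_fun A u -> cong k u u.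
Proof.
move=> su; split=> // m; apply: (eq_jdom oA Ap) (jdom0 oA Ap e m k) => x _ /=.
by rewrite subrr.
Qed.

Lemma congS k u1 u2 : cong k u1 u2 -> cong k.+1 u1 u2.
Proof. by move=> [s1 s2 J]; split => // m; exact: (jdomS e_mono (J m)). Qed.

Lemma congM k u1 u2 v1 v2 : cong k u1 u2 -> cong k v1 v2 ->
  cong k (fun x => u1 x * v1 x) (fun x => u2 x * v2 x).
Proof.
move=> [s1 s2 J] [t1 t2 K]; split; [exact: smooth_funM|exact: smooth_funM|] => m.
exact: (jdom_BM oA Ap e_mono (s1 m) (t2 m) (J m) (K m)).
Qed.

Lemma congD k u1 u2 v1 v2 : cong k u1 u2 -> cong k v1 v2 ->
  cong k (fun x => u1 x + v1 x) (fun x => u2 x + v2 x).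
Proof.
move=> [s1 s2 J] [t1 t2 K]; split; [exact: smooth_funD|exact: smooth_funD|] => m.
apply: (eq_jdom oA Ap) (jdomD oA Ap (J m) (K m)) => x _ /=; ring.
Qed.

Lemma congB k u1 u2 v1 v2 : cong k u1 u2 -> cong k v1 v2 ->
  cong k (fun x => u1 x - v1 x) (fun x => u2 x - v2 x).
Proof.
move=> [s1 s2 J] [t1 t2 K]; split; [exact: smooth_funB|exact: smooth_funB|] => m.
apply: (eq_jdom oA Ap) (jdomB oA Ap e_mono (J m) (K m)) => x _ /=; ring.
Qed.

Lemma cong_sum k (I : finType) (u v : I -> 'rV[R]_n -> R) :
  (forall i, cong k (u i) (v i)) -> cong k (fun x => \sum_i u i x) (fun x => \sum_i v i x).
Proof.
move=> uv; split; [| |move=> m].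
- by apply: smooth_fun_sum => // i; have [] := uv i.
- by apply: smooth_fun_sum => // i; have [] := uv i.
have J i : jdom A p e m k (u i \- v i) by have [_ _] := uv i.
by apply: (eq_jdom oA Ap) (jdom_sum oA Ap J) => x _ /=; rewrite sumrB.
Qed.

Lemma cong_partial k u1 u2 a : cong k u1 u2 -> cong k.+1 (partial a u1) (partial a u2).
Proof.
move=> [s1 s2 J]; split; [exact: smooth_fun_partial|exact: smooth_fun_partial|] => m.
exact: (jdom_Bpartial oA Ap a (s1 1%N) (s2 1%N) (J m.+1)).
Qed.

End Congruence.

(** * The two traces that determine the Hessian of the factor *)

Section ContractionAlgebra.
Context {R : realFieldType} {n : nat}.
Implicit Types (g G Q : 'I_n -> 'I_n -> R).

(** The terms in [Q] form the Kulkarni-Nomizu product of [Q] and [g], with arguments in the order j,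
    a, k, b, and the trace over a, b is the passage from curvature to Ricci. The trace of [g] is [n]
    and each mixed term gives [- Q j k], whence [n - 2]. *)
Lemma contract_kulkarni g G Q (z : 'I_n -> 'I_n -> R) j k :
  (forall a b, g a b = g b a) ->
  (forall a c, \sum_b G a b * g b c = (a == c)%:R) ->
  (forall a c, \sum_b g a b * G b c = (a == c)%:R) ->
  (forall a b, Q j k * g a b - Q j b * g a k - Q a k * g j b + Q a b * g j k + z a b = 0) ->
  (n%:R - 2) * Q j k + (\sum_a \sum_b G a b * Q a b) * g j k + \sum_a \sum_b G a b * z a b = 0.
Proof.
move=> gC Gg gG Kulk.
have T1 : \sum_a \sum_b G a b * g a b = n%:R.
  transitivity (\sum_(a < n) (1 : R)); last by rewrite sumr_const card_ord.
  apply: eq_bigr => a _; transitivity ((a == a)%:R : R); last by rewrite eqxx.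
  rewrite -Gg.
  by apply: eq_bigr => b _; rewrite (gC b a).
have T2 : \sum_a \sum_b G a b * (Q j b * g a k) = Q j k.
  rewrite exchange_big /= (bigD1 k) //= [X in _ + X]big1 ?addr0; last first.
    move=> b bk; transitivity (Q j b * (k == b)%:R); last by rewrite eq_sym (negbTE bk) mulr0.
    by rewrite -gG mulr_sumr; apply: eq_bigr => a _; rewrite (gC k a); ring.
  transitivity (Q j k * (k == k)%:R); last by rewrite eqxx mulr1.
  by rewrite -gG mulr_sumr; apply: eq_bigr => a _; rewrite (gC k a); ring.
have T3 : \sum_a \sum_b G a b * (Q a k * g j b) = Q j k.
  rewrite (bigD1 j) //= [X in _ + X]big1 ?addr0; last first.
    move=> a aj; transitivity (Q a k * (a == j)%:R); last by rewrite (negbTE aj) mulr0.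
    by rewrite -Gg mulr_sumr; apply: eq_bigr => b _; rewrite (gC j b); ring.
  transitivity (Q j k * (j == j)%:R); last by rewrite eqxx mulr1.
  by rewrite -Gg mulr_sumr; apply: eq_bigr => b _; rewrite (gC j b); ring.
have S : \sum_a \sum_b G a b *
   (Q j k * g a b - Q j b * g a k - Q a k * g j b + Q a b * g j k + z a b) = 0.
  by apply: big1 => a _; apply: big1 => b _; rewrite Kulk mulr0.
have E : \sum_a \sum_b G a b *
   (Q j k * g a b - Q j b * g a k - Q a k * g j b + Q a b * g j k + z a b) =
   Q j k * (\sum_a \sum_b G a b * g a b) - \sum_a \sum_b G a b * (Q j b * g a k)
   - \sum_a \sum_b G a b * (Q a k * g j b) + (\sum_a \sum_b G a b * Q a b) * g j k
   + \sum_a \sum_b G a b * z a b.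
  rewrite mulr_sumr mulr_suml -!sumrB -!big_split /=; apply: eq_bigr => a _.
  rewrite mulr_sumr mulr_suml -!sumrB -!big_split /=; apply: eq_bigr => b _; ring.
move: S; rewrite E T1 T2 T3.
move: (\sum_a \sum_b G a b * Q a b) (\sum_a \sum_b G a b * z a b) => t y <-; ring.
Qed.

(** The second trace, as from Ricci to scalar curvature: [2 n - 2] is [n - 2] from [Q] plus [n] from
    the trace of [g]. *)
Lemma contract_ricci g G Q (y : 'I_n -> 'I_n -> R) t :
  (forall a b, g a b = g b a) ->
  (forall a c, \sum_b G a b * g b c = (a == c)%:R) ->
  t = \sum_a \sum_b G a b * Q a b ->
  (forall j k, (n%:R - 2) * Q j k + t * g j k + y j k = 0) ->
  (2 * n%:R - 2) * t = - \sum_j \sum_k G j k * y j k.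
Proof.
move=> gC Gg tE Ric.
have T1 : \sum_a \sum_b G a b * g a b = n%:R.
  transitivity (\sum_(a < n) (1 : R)); last by rewrite sumr_const card_ord.
  apply: eq_bigr => a _; transitivity ((a == a)%:R : R); last by rewrite eqxx.
  rewrite -Gg.
  by apply: eq_bigr => b _; rewrite (gC b a).
have S : \sum_j \sum_k G j k * ((n%:R - 2) * Q j k + t * g j k + y j k) = 0.
  by apply: big1 => a _; apply: big1 => b _; rewrite Ric mulr0.
have E : \sum_j \sum_k G j k * ((n%:R - 2) * Q j k + t * g j k + y j k) =
  (n%:R - 2) * (\sum_a \sum_b G a b * Q a b) + t * (\sum_a \sum_b G a b * g a b)
  + \sum_j \sum_k G j k * y j k.
  rewrite !mulr_sumr -!big_split /=; apply: eq_bigr => a _.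
  rewrite !mulr_sumr -!big_split /=; apply: eq_bigr => b _; ring.
move: S; rewrite E T1 -tE; set Y := \sum_j _; lra.
Qed.

End ContractionAlgebra.

Lemma difference_identity {R : comNzRingType} (t1 t2 q1 q2 q3 q1' q2' q3' g1 g2 g3 r r' : R) :
  2 * t1 = q1 * g1 + q2 * g2 - q3 * g3 + r ->
  2 * t2 = q1' * g1 + q2' * g2 - q3' * g3 + r' ->
  2 * (t1 - t2) = (q1 - q1') * g1 + (q2 - q2') * g2 - (q3 - q3') * g3 + (r - r').
Proof. by move=> E1 E2; rewrite mulrBr E1 E2; ring. Qed.

Lemma mulrB_identity {R : comNzRingType} (t t' s s' : R) :
  t * s - t' * s' - t' * (s - s') = (t - t') * s.
Proof. ring. Qed.

Lemma solve_hessian {R : fieldType} (m t y gg q : R) : m != 0 -> m * q + t * gg + y = 0 ->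
  m^-1 * (-1 * (gg * t + y)) = q.
Proof.
move=> m0 E; rewrite -[RHS](mulKf m0); congr (_ * _).
by apply/eqP; rewrite mulN1r eq_sym -addr_eq0 (mulrC gg) addrA E.
Qed.

Lemma solve_third {R : realFieldType} (t q1 q2 q3 g1 g2 g3 z : R) :
  2 * t = q1 * g1 + q2 * g2 - q3 * g3 + z ->
  2^-1 * (g1 * q1 + g2 * q2 - g3 * q3 + z) = t.
Proof. lra. Qed.

Lemma sumr_mulr_delta {R : comNzRingType} (I : finType) (F : I -> R) l :
  \sum_i F i * (l == i)%:R = F l.
Proof.
rewrite (bigD1 l) //= eqxx mulr1 big1 ?addr0 // => i il.
by rewrite eq_sym (negbTE il) mulr0.
Qed.

Lemma kulkarni_identity {R : realFieldType} (t t' q1 q2 q3 q2' q4 q5 g1 g2 g3 g4 g5 z z' : R) :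
  2 * t = q1 * g1 + q2 * g2 - q3 * g3 + z ->
  2 * t' = q4 * g4 + q2' * g2 - q5 * g5 + z' -> t = t' -> q2 = q2' ->
  q1 * g1 - q3 * g3 - q4 * g4 + q5 * g5 + (z - z') = 0.
Proof. by move=> + + tt qq; rewrite tt qq => E1 E2; move: E1; rewrite E2; lra. Qed.

(** * Third derivatives of two conformal maps compared *)

Section TwoConformalMaps.
Context {R : realType} {n : nat}.
Hypothesis hn : (2 < n)%N.
Variables (A B : set 'rV[R]_n) (p : 'rV[R]_n).
Hypotheses (oA : open A) (Ap : A p) (oB : open B).
Variable e : nat -> 'rV[R]_n -> R.
Hypothesis e_mono : forall k x, e k x <= e k.+1 x.
Variables (g h G : 'I_n -> 'I_n -> 'rV[R]_n -> R).
Hypotheses (sg : forall a b, smooth_fun A (g a b)) (sh : forall a b, smooth_fun B (h a b)).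
Hypotheses (gC : forall a b x, A x -> g a b x = g b a x)
           (hC : forall a b x, B x -> h a b x = h b a x).
Hypothesis cG : forall a b, Cr 0 A (G a b).
Hypotheses (Gg : forall a c x, A x -> \sum_b G a b x * g b c x = (a == c)%:R)
           (gG : forall a c x, A x -> \sum_b g a b x * G b c x = (a == c)%:R).
Variables a0 b0 : 'I_n.
Hypothesis g0 : forall x, A x -> g a0 b0 x != 0.
Variables f1 f2 : 'rV[R]_n -> 'rV[R]_n.
Hypotheses (fB1 : forall x, A x -> B (f1 x)) (fB2 : forall x, A x -> B (f2 x)).
Hypotheses (sf1 : forall r, smooth_fun A (fun x => f1 x 0 r))
           (sf2 : forall r, smooth_fun A (fun x => f2 x 0 r)).
Hypothesis f12p : f1 p = f2 p.
Variables c1 c2 : 'rV[R]_n -> R.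
Hypothesis conf1 : forall a b x, A x ->
  \sum_l \sum_m partial a (fun z => f1 z 0 l) x * h l m (f1 x) * partial b (fun z => f1 z 0 m) x
  = c1 x * g a b x.
Hypothesis conf2 : forall a b x, A x ->
  \sum_l \sum_m partial a (fun z => f2 z 0 l) x * h l m (f2 x) * partial b (fun z => f2 z 0 m) x
  = c2 x * g a b x.
Hypothesis c10 : forall x, A x -> c1 x != 0.
Hypothesis df12 : forall l m, jdom A p e m 0 ((fun x => f1 x 0 l) \- (fun x => f2 x 0 l)).

Local Notation cong := (cong A p e).
Local Notation D := partial.
Local Notation C1 := (factor g h a0 b0 f1).
Local Notation C2 := (factor g h a0 b0 f2).

Lemma cong_component l : cong 0 (fun x => f1 x 0 l) (fun x => f2 x 0 l).
Proof. by split => // m; exact: df12. Qed.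

Lemma cong_pull l m : cong 0 (pull h f1 l m) (pull h f2 l m).
Proof.
split; [exact: (smooth_pull oA sh fB1 sf1)|exact: (smooth_pull oA sh fB2 sf2)|] => k.
by apply: (jdom_comp oA Ap e_mono oB fB1 fB2 sf1 sf2 f12p (sh l m)) => r; exact: df12.
Qed.

Lemma cong_lowered b l : cong 1 (lowered h f1 b l) (lowered h f2 b l).
Proof.
apply: (cong_sum oA Ap) => m; apply: (congM oA Ap e_mono).
  exact/(congS e_mono)/cong_pull.
exact/(cong_partial oA Ap)/cong_component.
Qed.

Lemma cong_factor : cong 1 C1 C2.
Proof.
apply: (congM oA Ap e_mono); last first.
  by apply: (cong_refl oA Ap); apply: (smooth_funV oA) => //; exact: sg.
apply: (cong_sum oA Ap) => m; apply: (congM oA Ap e_mono); last exact: cong_lowered.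
exact/(cong_partial oA Ap)/cong_component.
Qed.

Lemma cong_metric_variation a b k : cong 1 (metric_variation h f1 a b k) (metric_variation h f2 a b k).
Proof.
apply: (cong_sum oA Ap) => l; apply: (congM oA Ap e_mono).
  exact/(cong_partial oA Ap)/cong_component.
apply: (cong_sum oA Ap) => m; apply: (congM oA Ap e_mono).
  exact/(cong_partial oA Ap)/cong_pull.
exact/(cong_partial oA Ap)/cong_component.
Qed.

Lemma cong_rem1 a b k : cong 1 (rem1 g h a0 b0 f1 a b k) (rem1 g h a0 b0 f2 a b k).
Proof.
apply: (congB oA Ap e_mono); last exact: cong_metric_variation.
apply: (congM oA Ap e_mono); first exact: cong_factor.
apply: (cong_refl oA Ap); exact/smooth_fun_partial/sg.
Qed.

(** The bookkeeping point of the calculus: every factor in [rem2] has at most two derivatives of the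
    map. The closing term follows the parse tree of [rem2]. *)
Lemma cong_rem2 a k j b : cong 2 (rem2 g h a0 b0 f1 a k j b) (rem2 g h a0 b0 f2 a k j b).
Proof.
have cDg i i' j' : cong 2 (D i (g i' j')) (D i (g i' j')).
  by apply: (cong_refl oA Ap); exact/smooth_fun_partial/sg.
have cDC i : cong 2 (D i C1) (D i C2) by exact: (cong_partial oA Ap _ cong_factor).
have cDCDg i i' j' k' : cong 2 (fun x => D i C1 x * D k' (g i' j') x)
    (fun x => D i C2 x * D k' (g i' j') x).
  exact: (congM oA Ap e_mono (cDC i) (cDg k' i' j')).
have cDr a' b' k' i : cong 2 (D i (rem1 g h a0 b0 f1 a' b' k')) (D i (rem1 g h a0 b0 f2 a' b' k')).
  exact: (cong_partial oA Ap _ (cong_rem1 a' b' k')).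
have cl : cong 2 (fun x => cst 2 x * (\sum_l D k (D a (fun z => f1 z 0 l)) x * D j (lowered h f1 b l) x))
   (fun x => cst 2 x * (\sum_l D k (D a (fun z => f2 z 0 l)) x * D j (lowered h f2 b l) x)).
  apply: (congM oA Ap e_mono).
    by apply: (cong_refl oA Ap) => m; exact: Cr_cst.
  apply: (cong_sum oA Ap) => l; apply: (congM oA Ap e_mono).
    exact: (cong_partial oA Ap _ (cong_partial oA Ap _ (cong_component l))).
  exact: (cong_partial oA Ap _ (cong_lowered b l)).
exact: (congB oA Ap e_mono (congB oA Ap e_mono (congD oA Ap (congD oA Ap
  (congB oA Ap e_mono (congD oA Ap (cDCDg _ _ _ _) (cDCDg _ _ _ _)) (cDCDg _ _ _ _))
  (cDr _ _ _ _)) (cDr _ _ _ _)) (cDr _ _ _ _)) cl).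
Qed.

(** Differences bounded by the size of the 2-jet of f1 - f2. They are not differentiated any more,
    so continuous coefficients such as [G] are admissible. *)
Local Notation dom := (jdom A p e 0 2).

Let domM v w : Cr 0 A v -> dom w -> dom (fun x => v x * w x).
Proof. by move=> Cv; exact: (jdomM oA Ap e_mono). Qed.
Let domB v w : dom v -> dom w -> dom (fun x => v x - w x).
Proof. exact: (jdomB oA Ap e_mono). Qed.
Let domD v w : dom v -> dom w -> dom (fun x => v x + w x).
Proof. exact: (jdomD oA Ap). Qed.
Let dom_sum (I : finType) (w : I -> 'rV[R]_n -> R) :
  (forall i, dom (w i)) -> dom (fun x => \sum_i w i x).
Proof. exact: (jdom_sum oA Ap). Qed.
Let eq_dom v w : (forall x, A x -> v x = w x) -> dom v -> dom w.
Proof. exact: (eq_jdom oA Ap). Qed.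

Local Notation z a k j b := (fun x => rem2 g h a0 b0 f1 a k j b x - rem2 g h a0 b0 f2 a k j b x).
Local Notation Q a b := (fun x => D a (D b C1) x - D a (D b C2) x).
Local Notation T a k j b := (fun x =>
   \sum_l D j (D k (D a (fun z => f1 z 0 l))) x * lowered h f1 b l x
 - \sum_l D j (D k (D a (fun z => f2 z 0 l))) x * lowered h f2 b l x).

Lemma third_difference a k j b x : A x ->
  2 * T a k j b x = Q j k x * g a b x + Q j a x * g k b x - Q j b x * g a k x + z a k j b x.
Proof.
move=> Ax.
have E1 := third_derivative oA sg sh hC g0 fB1 sf1 conf1 a k j b Ax.
have E2 := third_derivative oA sg sh hC g0 fB2 sf2 conf2 a k j b Ax.
exact: (difference_identity E1 E2).
Qed.

Let sD (u : 'rV[R]_n -> R) a : smooth_fun A u -> smooth_fun A (D a u).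
Proof. exact: smooth_fun_partial. Qed.

(** The exchange of the outer indices is a product of three adjacent transpositions; the one below
    [D k] uses the symmetry on all of [A], not just at [x]. *)
Lemma third_partialC (f : 'rV[R]_n -> 'rV[R]_n) a k j l x :
  (forall r, smooth_fun A (fun x => f x 0 r)) -> A x ->
  D j (D k (D a (fun z => f z 0 l))) x = D a (D k (D j (fun z => f z 0 l))) x.
Proof.
move=> sf Ax.
have S1 : D j (D k (D a (fun z => f z 0 l))) x = D k (D j (D a (fun z => f z 0 l))) x.
  exact: (partial_commute _ _ oA Ax (sD a (sf l) 2%N)).
have S2 : D k (D j (D a (fun z => f z 0 l))) x = D k (D a (D j (fun z => f z 0 l))) x.
  by apply: (eq_partial _ oA _ Ax) => y Ay; exact: (partial_commute _ _ oA Ay (sf l 2%N)).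
have S3 : D k (D a (D j (fun z => f z 0 l))) x = D a (D k (D j (fun z => f z 0 l))) x.
  exact: (partial_commute _ _ oA Ax (sD j (sf l) 2%N)).
exact (etrans S1 (etrans S2 S3)).
Qed.

Lemma third_differenceC a k j b x : A x -> T a k j b x = T j k a b x.
Proof.
move=> Ax.
have H (f : 'rV[R]_n -> 'rV[R]_n) : (forall r, smooth_fun A (fun x => f x 0 r)) ->
    \sum_l D j (D k (D a (fun z => f z 0 l))) x * lowered h f b l x =
    \sum_l D a (D k (D j (fun z => f z 0 l))) x * lowered h f b l x.
  move=> sf; apply: eq_bigr => l _.
  exact (congr1 ( *%R^~ (lowered h f b l x)) (third_partialC a k j l sf Ax)).
exact (f_equal2 (fun s t => s - t) (H _ sf1) (H _ sf2)).
Qed.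

Lemma factor_hessianC a b x : A x -> Q a b x = Q b a x.
Proof.
move=> Ax.
have H1 := partial_commute a b oA Ax (smooth_factor oA sg sh g0 fB1 sf1 2%N).
have H2 := partial_commute a b oA Ax (smooth_factor oA sg sh g0 fB2 sf2 2%N).
exact (f_equal2 (fun s t => s - t) H1 H2).
Qed.

Local Notation zeta j k a b := (fun x => z a k j b x - z j k a b x).

(** The formulas for the third derivatives (a, k, j) and (j, k, a) are subtracted: f''' disappears,
    and so do the terms with [g k b], by the symmetry of the Hessian of the factor. *)
Lemma kulkarni_hessian j k a b x : A x ->
  Q j k x * g a b x - Q j b x * g a k x - Q a k x * g j b x + Q a b x * g j k x
  + zeta j k a b x = 0.
Proof.
move=> Ax.
exact (kulkarni_identity (third_difference a k j b Ax) (third_difference j k a b Ax)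
  (third_differenceC a k j b Ax) (factor_hessianC j a Ax)).
Qed.

Lemma dom_zeta j k a b : dom (zeta j k a b).
Proof.
have dz a' k' j' b' : dom (z a' k' j' b') by have [_ _] := cong_rem2 a' k' j' b'; exact.
exact: (domB (dz _ _ _ _) (dz _ _ _ _)).
Qed.

Local Notation Y j k := (fun x => \sum_a \sum_b G a b x * zeta j k a b x).
Local Notation tau := (fun x => \sum_a \sum_b G a b x * Q a b x).

Lemma dom_Y j k : dom (Y j k).
Proof.
apply: dom_sum => a; apply: dom_sum => b; apply: domM => //.
exact: dom_zeta.
Qed.

Lemma ricci_hessian j k x : A x ->
  (n%:R - 2) * Q j k x + tau x * g j k x + Y j k x = 0.
Proof.
move=> Ax.
exact (@contract_kulkarni R n (fun a b => g a b x) (fun a b => G a b x) (fun a b => Q a b x)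
  (fun a b => zeta j k a b x) j k (fun a b => gC a b Ax) (fun a c => Gg a c Ax)
  (fun a c => gG a c Ax) (fun a b => kulkarni_hessian j k a b Ax)).
Qed.

Lemma dom_tau : dom tau.
Proof.
have n0 : 2 * n%:R - 2 != 0 :> R.
  have : (2 : R) < n%:R by rewrite ltr_nat.
  by move=> n2; apply: lt0r_neq0; lra.
have D1 : dom (fun x => (2 * n%:R - 2)^-1 * (-1 * \sum_j \sum_k G j k x * Y j k x)).
  apply: domM; first exact: Cr_cst.
  apply: domM; first exact: Cr_cst.
  apply: dom_sum => a; apply: dom_sum => b; apply: domM => //.
  exact: dom_Y.
apply: eq_dom D1 => x Ax.
have E := @contract_ricci R n (fun a b => g a b x) (fun a b => G a b x) (fun a b => Q a b x)
  (fun j k => Y j k x) (tau x) (fun a b => gC a b Ax) (fun a c => Gg a c Ax) erefl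
  (fun j k => ricci_hessian j k Ax).
by rewrite mulN1r; rewrite -E mulKf.
Qed.

(** Once its trace is dominated, the Hessian follows by dividing by [n - 2]; this is the step that
    dimension two does not allow. *)
Lemma dom_factor_hessian j k : dom (Q j k).
Proof.
have n0 : n%:R - 2 != 0 :> R.
  have : (2 : R) < n%:R by rewrite ltr_nat.
  by move=> n2; apply: lt0r_neq0; lra.
have cg : Cr 0 A (g j k) by exact: (sg j k 0%N).
have D1 : dom (fun x => (n%:R - 2)^-1 * (-1 * (g j k x * tau x + Y j k x))).
  apply: domM; first exact: Cr_cst.
  apply: domM; first exact: Cr_cst.
  exact: (domD (domM cg dom_tau) (dom_Y j k)).
apply: eq_dom D1 => x Ax.
exact (solve_hessian n0 (ricci_hessian j k Ax)).
Qed.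

Lemma dom_third_lowered a k j b : dom (T a k j b).
Proof.
have cg a' b' : Cr 0 A (g a' b') by exact: (sg a' b' 0%N).
have dz : dom (z a k j b) by have [_ _] := cong_rem2 a k j b; exact.
have D1 : dom (fun x => 2^-1 * (g a b x * Q j k x + g k b x * Q j a x - g a k x * Q j b x
    + z a k j b x)).
  apply: domM; first exact: Cr_cst.
  apply: domD dz; apply: domB; first apply: domD.
  - exact: (domM (cg a b) (dom_factor_hessian j k)).
  - exact: (domM (cg k b) (dom_factor_hessian j a)).
  - exact: (domM (cg a k) (dom_factor_hessian j b)).
apply: eq_dom D1 => x Ax.
exact (solve_third (third_difference a k j b Ax)).
Qed.

(* The matrix [J^T g^-1 / c1], which inverts [lowered] because [J h J^T = c1 g]. *)
Let K m b x := (C1 x)^-1 * \sum_a D a (fun z => f1 z 0 m) x * G a b x.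

Lemma lowered_inverse m l x : A x -> \sum_b K m b x * lowered h f1 b l x = (m == l)%:R.
Proof.
move=> Ax.
pose J : 'M[R]_n := \matrix_(a, m) D a (fun z => f1 z 0 m) x.
pose P : 'M[R]_n := \matrix_(b, l) lowered h f1 b l x.
pose gm : 'M[R]_n := \matrix_(a, b) g a b x.
pose Gm : 'M[R]_n := \matrix_(a, b) G a b x.
have cx : C1 x = c1 x by exact: (factorE g0 conf1).
have PJ : P *m J^T = c1 x *: gm.
  apply/matrixP => b a; rewrite !mxE gC // -(conformal_lowered conf1 a b Ax).
  by apply: eq_bigr => i _; rewrite !mxE mulrC.
have gGm : gm *m Gm = 1%:M.
  by apply/matrixP => b a; rewrite !mxE -(gG b a Ax); apply: eq_bigr => i _; rewrite !mxE.
have PK : P *m ((c1 x)^-1 *: (J^T *m Gm)) = 1%:M.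
  by rewrite -scalemxAr mulmxA PJ -scalemxAl gGm scalerA mulVf ?scale1r // c10.
(* [K] has to act on the index [b] of [lowered], that is, from the left; a right inverse of a square
   matrix is also a left inverse. *)
have := mulmx1C PK => /matrixP /(_ m l); rewrite !mxE => <-.
apply: eq_bigr => b _; rewrite !mxE /K cx; congr (_ * _ * _).
by apply: eq_bigr => a _; rewrite !mxE.
Qed.

(** The third derivatives of the two maps are contracted with different covectors. Using that of
    [f1] for both costs f2''' times the difference of the covectors, which has level 1; then [K]
    removes the contraction. *)
Lemma dom_third_partial a k j l :
  dom (fun x => D j (D k (D a (fun z => f1 z 0 l))) x - D j (D k (D a (fun z => f2 z 0 l))) x).
Proof.
pose d l x := D j (D k (D a (fun z => f1 z 0 l))) x - D j (D k (D a (fun z => f2 z 0 l))) x.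
have dU b : dom (fun x => \sum_l d l x * lowered h f1 b l x).
  have D1 : dom (fun x => \sum_l D j (D k (D a (fun z => f2 z 0 l))) x *
      (lowered h f1 b l x - lowered h f2 b l x)).
    apply: dom_sum => i; apply: domM; first exact: (sD j (sD k (sD a (sf2 i))) 0%N).
    by have [_ _ /(_ 0%N) H] := cong_lowered b i; exact: (jdomS e_mono H).
  apply: eq_dom (domB (dom_third_lowered a k j b) D1) => x Ax.
  rewrite -!sumrB; apply: eq_bigr => i _; rewrite /d; exact: mulrB_identity.
have cK m b : Cr 0 A (K m b).
  apply: (CrM oA).
    apply: (CrV oA); last exact: (smooth_factor oA sg sh g0 fB1 sf1 0%N).
    by move=> x Ax; rewrite (factorE g0 conf1) // c10.
  by apply: (Cr_sum oA) => i; apply: (CrM oA) => //; exact: (sD i (sf1 m) 0%N).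
have D2 : dom (fun x => \sum_b K l b x * (\sum_i d i x * lowered h f1 b i x)).
  by apply: dom_sum => b; apply: domM.
apply: eq_dom D2 => x Ax.
transitivity (\sum_i d i x * (l == i)%:R).
  under eq_bigr => b _ do rewrite mulr_sumr.
  rewrite exchange_big /=; apply: eq_bigr => i _.
  rewrite -(lowered_inverse l i Ax) mulr_sumr; apply: eq_bigr => b _.
  exact: mulrCA.
exact (sumr_mulr_delta (fun i => d i x) l).
Qed.

End TwoConformalMaps.

(** * Uniqueness *)

Section Gronwall.
Context {R : realType}.

(** The function [E s * expR (- k * s)] has nonpositive derivative, so the mean value theorem
    compares its values at 0 and 1. *)
Lemma gronwall (E dE : R -> R) (k : R) :
  (forall s : R, 0 <= s <= 1 -> is_derive s 1 E (dE s)) ->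
  (forall s : R, 0 <= s <= 1 -> dE s <= k * E s) -> E 0 = 0 -> E 1 <= 0.
Proof.
move=> dEs le_dE E0.
pose G (s : R) := E s * expR (- k * s).
have dG (s : R) : 0 <= s <= 1 -> is_derive s 1 G ((dE s - k * E s) * expR (- k * s)).
  move=> hs; have H1 := dEs s hs.
  have H2 : is_derive s 1 (fun s : R => - k * s) (- k).
    by apply: is_derive_eq (is_deriveZ _ _) _; rewrite /GRing.scale /= mulr1.
  have H3 : is_derive s 1 (fun s : R => expR (- k * s)) (- k * expR (- k * s)).
    by apply: is_derive_eq (is_derive1_comp _ _) _; rewrite /GRing.scale /= mulrC.
  apply: is_derive_eq (is_deriveM H1 H3) _; rewrite /GRing.scale /=; ring.
have [s||s hs] := @MVT R G (fun s => (dE s - k * E s) * expR (- k * s)) 0 1 ltr01.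
- by rewrite in_itv /= => /andP[s0 s1]; apply: dG; rewrite !ltW.
- by apply: derivable_within_continuous => s; rewrite in_itv /= => /dG; case.
rewrite {1 2}/G E0 mul0r subr0 subr0 mulr1 => E1.
have : E 1 * expR (- k * 1) <= 0.
  rewrite E1 mulr_le0_ge0 ?expR_ge0 // subr_le0; apply: le_dE.
  by move: hs; rewrite in_itv /= => /andP[s0 s1]; rewrite !ltW.
by rewrite pmulr_lle0 // expR_gt0.
Qed.

Lemma vanish_along_lines n (I : finType) (A : set 'rV[R]_n) p (w : I -> 'rV[R]_n -> R) (C : R) :
  open A -> A p -> 0 <= C -> (forall i x, A x -> differentiable (w i) x) ->
  (forall i, w i p = 0) ->
  (\forall x \near p, forall i a, `|partial a (w i) x| <= C * \sum_j `|w j x|) ->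
  \forall x \near p, forall i, w i x = 0.
Proof.
move=> oA Ap C0 dw w0 Hw.
have nA : \forall z \near p, A z by exact: open_nbhs_nbhs.
have [r /= r0 rP] := (nbhs_ballP _ _).1 (filterI nA Hw).
apply/nbhs_ballP; exists r => //= x xr.
pose v := x - p; pose y (s : R) := p + s *: v.
have yb (s : R) : 0 <= s <= 1 -> ball p r (y s).
  move=> /andP[s0 s1]; move: xr; rewrite -!ball_normE /= /y opprD addrA subrr add0r normrN.
  rewrite normrZ ger0_norm // -opprB normrN; apply: le_lt_trans; exact: ler_piMl.
pose N := \sum_a `|v 0 a|.
pose S (s : R) := \sum_j `|w j (y s)|.
have N0 : 0 <= N by exact: sumr_ge0.
have Dv i (s : R) : 0 <= s <= 1 -> `|'D_v (w i) (y s)| <= N * C * S s.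
  move=> hs; have [Ay Hy] := rP _ (yb s hs).
  rewrite derive_partial; last exact: dw.
  rewrite (le_trans (ler_norm_sum _ _ _)) // -mulrA mulr_suml ler_sum // => a _.
  by rewrite normrM ler_wpM2l // Hy.
(* Squares replace the absolute values of [S] in order to be differentiable. *)
pose E (s : R) := \sum_i (w i (y s)) ^+ 2.
pose dE (s : R) := \sum_i (w i (y s) * 'D_v (w i) (y s) *+ 2).
have dEs (s : R) : 0 <= s <= 1 -> is_derive s 1 E (dE s).
  move=> hs; have [Ay _] := rP _ (yb s hs).
  have d1 i : is_derive s 1 (fun s => w i (y s) ^+ 2) (w i (y s) * 'D_v (w i) (y s) *+ 2).
    have H := is_derive_line (dw i _ Ay).
    rewrite (_ : (fun _ => _) = (fun s => w i (y s)) * (fun s => w i (y s))); last first.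
      by apply/funext => t; rewrite expr2.
    by apply: is_derive_eq (is_deriveM H H) _; rewrite /GRing.scale /= -mulr2n.
  have -> : E = \sum_i (fun s => w i (y s) ^+ 2) by apply/funext => t; rewrite fct_sumE.
  have -> : dE s = \sum_i (w i (y s) * 'D_v (w i) (y s) *+ 2) by [].
  by elim/big_ind2 : _ => // *; [exact: is_derive_cst|exact: is_deriveD].
(* From 2 |w_i| |w_j| <= w_i^2 + w_j^2, summed over all pairs: each square occurs [2 * #|I|]
   times. *)
pose k := 2 * (N * C) * #|I|%:R.
have k0 : 0 <= N * C by exact: mulr_ge0.
have dEk (s : R) : 0 <= s <= 1 -> dE s <= k * E s.
  move=> hs; rewrite /dE /k.
  apply: (@le_trans _ _ (\sum_i (N * C) * (\sum_j (w i (y s) ^+ 2 + w j (y s) ^+ 2)))).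
    apply: ler_sum => i _.
    rewrite (le_trans (ler_norm _)) // normrMn normrM.
    apply: (@le_trans _ _ (`|w i (y s)| * (N * C * S s) *+ 2)).
      by rewrite lerMn2r ler_wpM2l // Dv.
    rewrite mulrCA -mulrnAr ler_wpM2l // /S mulr_sumr -mulr_natr mulr_suml ler_sum // => j _.
    rewrite -(real_normK (num_real (w i (y s)))) -(real_normK (num_real (w j (y s)))).
    by rewrite -subr_ge0 mulr_natr addrAC -sqrrB sqr_ge0.
  rewrite -mulr_sumr; have -> : \sum_i \sum_j (w i (y s) ^+ 2 + w j (y s) ^+ 2) = E s *+ #|I| *+ 2.
    under eq_bigr => i _ do rewrite big_split /= sumr_const.
    by rewrite big_split /= sumr_const sumrMnl mulr2n.
  have aux (a b t : R) : a * (t * b * 2) = 2 * a * b * t by ring.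
  by rewrite -(mulr_natr (E s *+ _)) -(mulr_natr (E s)) aux.
have E0 : E 0 = 0.
  by rewrite /E big1 // => i _; rewrite /y scale0r addr0 w0 expr0n.
have := gronwall dEs dEk E0.
rewrite /E /y scale1r /v subrKC => E1 i.
have : w i x ^+ 2 <= 0.
  apply: le_trans E1; rewrite (bigD1 i) //= lerDl; apply: sumr_ge0 => j _; exact: sqr_ge0.
by rewrite exprn_even_le0 //= => /eqP.
Qed.

End Gronwall.

(** * Local uniqueness in coordinates *)

Section LocalUniqueness.
Context {R : realType} {n : nat}.
Hypothesis hn : (2 < n)%N.
Variables (A B : set 'rV[R]_n) (p : 'rV[R]_n).
Hypotheses (oA : open A) (Ap : A p) (oB : open B).
Variables (g h : 'I_n -> 'I_n -> 'rV[R]_n -> R).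
Hypotheses (sg : forall a b, smooth_fun A (g a b)) (sh : forall a b, smooth_fun B (h a b)).
Hypotheses (gC : forall a b x, A x -> g a b x = g b a x)
           (hC : forall a b x, B x -> h a b x = h b a x).
Hypothesis gU : forall x, A x -> \matrix_(a, b) g a b x \in unitmx.
Variables a0 b0 : 'I_n.
Hypothesis g0 : forall x, A x -> g a0 b0 x != 0.
Variables f1 f2 : 'rV[R]_n -> 'rV[R]_n.
Hypotheses (fB1 : forall x, A x -> B (f1 x)) (fB2 : forall x, A x -> B (f2 x)).
Hypotheses (sf1 : forall r, smooth_fun A (fun x => f1 x 0 r))
           (sf2 : forall r, smooth_fun A (fun x => f2 x 0 r)).
Variables c1 c2 : 'rV[R]_n -> R.
Hypothesis conf1 : forall a b x, A x ->
  \sum_l \sum_m partial a (fun z => f1 z 0 l) x * h l m (f1 x) * partial b (fun z => f1 z 0 m) x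
  = c1 x * g a b x.
Hypothesis conf2 : forall a b x, A x ->
  \sum_l \sum_m partial a (fun z => f2 z 0 l) x * h l m (f2 x) * partial b (fun z => f2 z 0 m) x
  = c2 x * g a b x.
Hypothesis c10 : forall x, A x -> c1 x != 0.
Hypothesis jet0 : f1 p = f2 p.
Hypothesis jet1 : forall a l,
  partial a (fun z => f1 z 0 l) p = partial a (fun z => f2 z 0 l) p.
Hypothesis jet2 : forall a b l,
  partial a (partial b (fun z => f1 z 0 l)) p = partial a (partial b (fun z => f2 z 0 l)) p.

Local Notation D := partial.
Let d l := (fun x => f1 x 0 l) \- (fun x => f2 x 0 l).
Let e k x := \sum_l jet k (d l) x.
(* The components of the 2-jet of [f1 - f2]; they satisfy a linear differential
   inequality along lines. *)
Let w (i : 'I_n + ('I_n * 'I_n + 'I_n * 'I_n * 'I_n)) : 'rV[R]_n -> R :=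
  match i with
  | inl l => d l
  | inr (inl la) => D la.2 (d la.1)
  | inr (inr lab) => D lab.2 (D lab.1.2 (d lab.1.1))
  end.

Let e_mono k x : e k x <= e k.+1 x.
Proof. by apply: ler_sum => l _; exact: jetS. Qed.

Let sd l : smooth_fun A (d l).
Proof. exact: smooth_funB. Qed.

Let sw i : smooth_fun A (w i).
Proof.
case: i => [l|[la|lab]]; first exact: sd.
  exact/smooth_fun_partial/sd.
exact/smooth_fun_partial/smooth_fun_partial/sd.
Qed.

Let dfd l m : jdom A p e m 0 (d l).
Proof.
apply: jdom_jet => // j x; rewrite add0n /e (bigD1 l) //= lerDl.
by apply: sumr_ge0 => i _; exact: jet_ge0.
Qed.

Let e2E x : e 2 x = \sum_i `|w i x|.
Proof.
rewrite big_sumType /= big_sumType /= -(pair_bigA _ (fun l a => `|D a (d l) x|)).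
rewrite -(pair_bigA _ (fun la b => `|D b (D la.2 (d la.1)) x|)) /=.
rewrite -(pair_bigA _ (fun l a => \sum_b `|D b (D a (d l)) x|)) /=.
rewrite -!big_split /=; apply: eq_bigr => l _; congr (_ + _).
by rewrite -big_split.
Qed.

Let d1E a l x : A x -> D a (d l) x = D a (fun z => f1 z 0 l) x - D a (fun z => f2 z 0 l) x.
Proof. by move=> Ax; apply: partialB; [exact: smooth_fun_diff (sf1 l) Ax|exact: smooth_fun_diff (sf2 l) Ax]. Qed.

Let d2E a b l x : A x -> D b (D a (d l)) x =
  D b (D a (fun z => f1 z 0 l)) x - D b (D a (fun z => f2 z 0 l)) x.
Proof.
move=> Ax; have s1 := smooth_fun_partial a (sf1 l); have s2 := smooth_fun_partial a (sf2 l).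
have E := eq_partial b oA (fun y Ay => @d1E a l y Ay) Ax.
exact (etrans E (partialB _ (smooth_fun_diff s1 Ax) (smooth_fun_diff s2 Ax))).
Qed.

Let d3E a b c l x : A x -> D c (D b (D a (d l))) x =
  D c (D b (D a (fun z => f1 z 0 l))) x - D c (D b (D a (fun z => f2 z 0 l))) x.
Proof.
move=> Ax; have s1 := smooth_fun_partial b (smooth_fun_partial a (sf1 l)).
have s2 := smooth_fun_partial b (smooth_fun_partial a (sf2 l)).
have E := eq_partial c oA (fun y Ay => @d2E a b l y Ay) Ax.
exact (etrans E (partialB _ (smooth_fun_diff s1 Ax) (smooth_fun_diff s2 Ax))).
Qed.

(** Derivatives of the components of order 0 and 1 are again part of the 2-jet. Only those of order
    2 need the conformal equations, through [dom_third_partial]. *)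
Lemma bigO_partial_jet i a : bigO_at p e 2 (D a (w i)).
Proof.
case: i => [l|[[l b]|[[l b] c]]].
- exact: (jdom_bigO (jdomS e_mono (jdom_partial a (dfd l 1)))).
- exact: (jdom_bigO (jdom_partial a (jdom_partial b (dfd l 2)))).
pose G i j x := invmx (\matrix_(a, b) g a b x) i j.
have cG i j : Cr 0 A (G i j).
  apply: (Cr_invmx oA (G := fun x => \matrix_(a, b) g a b x)) => // a' b'.
  by apply: (eq_Cr oA) (sg a' b' 0%N) => x _; rewrite mxE.
have Gg i j x : A x -> \sum_k G i k x * g k j x = (i == j)%:R.
  move=> Ax; have := mulVmx (gU Ax) => /matrixP /(_ i j); rewrite !mxE => <-.
  by apply: eq_bigr => k _; rewrite mxE.
have gG i j x : A x -> \sum_k g i k x * G k j x = (i == j)%:R.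
  move=> Ax; have := mulmxV (gU Ax) => /matrixP /(_ i j); rewrite !mxE => <-.
  by apply: eq_bigr => k _; rewrite mxE.
have H := dom_third_partial hn oA Ap oB e_mono sg sh gC hC cG Gg gG g0 fB1 fB2 sf1 sf2
  jet0 conf1 conf2 c10 dfd b c a l.
apply: (eq_bigO_at oA Ap) (jdom_bigO H) => x Ax.
exact/esym/d3E.
Qed.

Theorem two_jet_determines_near : \forall x \near p, f1 x = f2 x.
Proof.
(* One constant for the finitely many pairs: the sum of the constants chosen from
   [bigO_partial_jet]. *)
pose C := \sum_i \sum_a s2val (cid2 (bigO_partial_jet i a)).
have C_ge0 i a : 0 <= s2val (cid2 (bigO_partial_jet i a)) by case: (cid2 _).
have C0 : 0 <= C by apply: sumr_ge0 => i _; apply: sumr_ge0 => a _; exact: C_ge0.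
have Hw : \forall x \near p, forall i a, `|D a (w i) x| <= C * \sum_j `|w j x|.
  have Hia i a : \forall x \near p, `|D a (w i) x| <= C * \sum_j `|w j x|.
    have Ci : s2val (cid2 (bigO_partial_jet i a)) <= C.
      rewrite /C (bigD1 i) //= (bigD1 a) //= -addrA lerDl addr_ge0 //.
        by apply: sumr_ge0.
      by apply: sumr_ge0 => j _; apply: sumr_ge0.
    case: (cid2 _) Ci => c /= c0 Hc cC; near=> x.
    rewrite -e2E (@le_trans _ _ (c * e 2 x)) //; first by near: x.
    by rewrite ler_wpM2r // e2E sumr_ge0.
  have Hi i := @filter_forall _ _ _ (nbhs p) (nbhs_filter p) (Hia i).
  exact (@filter_forall _ _ _ (nbhs p) (nbhs_filter p) Hi).
have w0 i : w i p = 0.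
  case: i => [l|[[l b]|[[l b] c]]] /=.
  - by rewrite /d /= jet0 subrr.
  - by rewrite d1E // jet1 subrr.
  - by rewrite d2E // jet2 subrr.
have := vanish_along_lines oA Ap C0 (fun i x Ax => smooth_fun_diff (sw i) Ax) w0 Hw.
apply: filterS => x H; apply/rowP => l; apply/eqP; rewrite -subr_eq0.
by apply/eqP; exact: (H (inl l)).
Unshelve. all: by end_near. Qed.

End LocalUniqueness.

(** * Lorentzian matrices *)

Section LorentzMatrix.
Context {R : realType} {n : nat}.
Implicit Type B : 'M[R]_n.

Lemma lorentzian_mx_unit B : lorentzian_mx B -> B \in unitmx.
Proof.
move=> [P uP E].
have uM : minkowski_mx R n \in unitmx.
  rewrite unitmxE det_diag unitfE prodf_seq_neq0; apply/allP => i _ /=.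
  by rewrite !mxE; case: ifP => _; rewrite ?oppr_eq0 oner_eq0.
by move: uM; rewrite -E !unitmx_mul => /andP[/andP[]].
Qed.

(** Symmetry is not a field of [lorentz_metric]; it comes from the congruence with a diagonal
    matrix. *)
Lemma lorentzian_mx_sym B : lorentzian_mx B -> B^T = B.
Proof.
move=> [P uP E].
have EB : B = invmx P *m minkowski_mx R n *m invmx P^T.
  by rewrite -E !mulmxA mulVmx // mul1mx mulmxK // unitmx_tr.
by rewrite EB !trmx_mul -!trmx_inv trmxK tr_diag_mx mulmxA.
Qed.

End LorentzMatrix.

Section ChartFacts.
Context {R : realType} {n : nat} {M : manifold R n}.
Implicit Types (x : chart R n M) (p : M).

Lemma chart_mapK x p : atlas x -> chart_dom x p -> chart_inv x (chart_map x p) = p.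
Proof. by move=> /atlas_chart [_ _ H _ _]; exact: H. Qed.

Lemma chart_img_map x p : chart_dom x p -> chart_img x (chart_map x p).
Proof. by move=> xp; exists p. Qed.

Lemma chart_invK x v : atlas x -> chart_img x v -> chart_map x (chart_inv x v) = v.
Proof. by move=> ax [p xp <-]; rewrite chart_mapK. Qed.

Lemma chart_dom_inv x v : atlas x -> chart_img x v -> chart_dom x (chart_inv x v).
Proof. by move=> ax [p xp <-]; rewrite chart_mapK. Qed.

Lemma chart_img_open x : atlas x -> open (chart_img x).
Proof. by move=> /atlas_chart []. Qed.

Lemma chart_dom_open x : atlas x -> open (chart_dom x).
Proof. by move=> /atlas_chart []. Qed.

Lemma near_chart_dom x p : atlas x -> chart_dom x p -> \forall q \near p, chart_dom x q.
Proof. by move=> ax xp; apply: open_nbhs_nbhs; split => //; exact: chart_dom_open. Qed.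

Lemma near_chart_map x p (P : set 'rV[R]_n) : atlas x -> chart_dom x p ->
  (\forall v \near chart_map x p, P v) -> \forall q \near p, P (chart_map x q).
Proof. by move=> /atlas_chart [_ _ _ H _] xp HP; exact: H. Qed.

Lemma near_chart_inv x p (P : set M) : atlas x -> chart_dom x p ->
  (\forall q \near p, P q) -> \forall v \near chart_map x p, P (chart_inv x v).
Proof.
move=> ax xp HP; have [_ _ _ _ H] := atlas_chart ax.
by apply: (H _ (chart_img_map xp)); rewrite chart_mapK.
Qed.

Lemma metric_component_smooth (g : lorentz_metric M) x a b : atlas x ->
  smooth_fun (chart_img x) (fun v => g x (chart_inv x v) a b).
Proof.
move=> ax k; exact: (@smooth_on_Cr _ _ _ (chart_img_open ax) k _ _ (g x \o chart_inv x) a b (metric_smooth g ax)).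
Qed.

End ChartFacts.

(** * Maps between manifolds in charts *)

Section LocalRepresentation.
Context {R : realType} {n : nat} {M N : manifold R n}.
Implicit Types (x : chart R n M) (y : chart R n N) (F : M -> N).

Lemma local_repE F x y p : atlas x -> chart_dom x p ->
  local_rep F x y (chart_map x p) = chart_map y (F p).
Proof. by move=> ax xp; rewrite /local_rep /= chart_mapK. Qed.

Definition rep_dom F x y := [set v | chart_img x v /\ chart_dom y (F (chart_inv x v))].

Lemma rep_dom_map F x y p : atlas x -> chart_dom x p -> chart_dom y (F p) ->
  rep_dom F x y (chart_map x p).
Proof. by move=> ax xp yFp; split; [exact: chart_img_map|rewrite chart_mapK]. Qed.

Lemma rep_dom_open F x y : (forall p, {for p, continuous F}) -> atlas x -> atlas y ->
  open (rep_dom F x y).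
Proof.
move=> cF ax ay; rewrite openE => v [xv yv]; have [p xp vE] := xv.
have Fp : chart_dom y (F p) by move: yv; rewrite -vE chart_mapK.
have N1 : \forall w \near v, chart_img x w.
  by apply: open_nbhs_nbhs; split => //; exact: chart_img_open.
have N2 : \forall w \near v, chart_dom y (F (chart_inv x w)).
  by rewrite -vE; exact: (@near_chart_inv _ _ _ _ _ (fun q => chart_dom y (F q)) ax xp (cF p _ (near_chart_dom ay Fp))).
exact: (filterI N1 N2).
Qed.

Lemma local_rep_smooth F x y : smooth_map F -> atlas x -> atlas y ->
  smooth_on (rep_dom F x y) (local_rep F x y).
Proof.
move=> [_ sF] ax ay; have := sF x y ax ay; congr smooth_on; apply/seteqP; split.
  by move=> _ [p [[_ xp] yFp] <-]; exact: rep_dom_map.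
move=> v [[p xp <-]]; rewrite chart_mapK // => yFp.
by exists p.
Qed.

Lemma local_rep_smooth_fun F x y l : smooth_map F -> atlas x -> atlas y ->
  smooth_fun (rep_dom F x y) (fun v => local_rep F x y v 0 l).
Proof.
move=> sF ax ay k; apply: smooth_on_Cr; last exact: local_rep_smooth.
by apply: rep_dom_open => // p; apply: (sF.1 p).
Qed.

Lemma local_rep_diff F x y v : smooth_map F -> atlas x -> atlas y -> rep_dom F x y v ->
  differentiable (local_rep F x y) v.
Proof. by move=> sF ax ay vr; have [+ _] := local_rep_smooth sF ax ay 1%N; exact. Qed.

Lemma local_rep_mem F x y v : rep_dom F x y v -> chart_img y (local_rep F x y v).
Proof. by move=> [_ yv]; exact: chart_img_map. Qed.

(** Chain rule for the local inverse [G]: in charts, [k \o f] is the identity near [v]. *)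
Lemma local_diffeo_jacobian F x y v : local_diffeo F -> atlas x -> atlas y ->
  rep_dom F x y v -> 'J (local_rep F x y) v \in unitmx.
Proof.
move=> [sF diF] ax ay vr; have [[p xp vE] _] := vr.
have yFp : chart_dom y (F p) by move: vr.2; rewrite -vE chart_mapK.
have [U [G [oU Up oFU GF [_ sG]]]] := diF p.
set f := local_rep F x y; set k := local_rep G y x.
have df : differentiable f v by exact: local_rep_diff.
have fv : f v = chart_map y (F p) by rewrite -vE /f local_repE.
have dk : differentiable k (f v).
  have [+ _] := sG y x ay ax 1%N; apply; rewrite fv.
  exists (F p) => //; split; first by split => //; exists p.
  by rewrite /= GF.
have kf : {near v, k \o f =1 id}.
  have nU : \forall w \near v, U (chart_inv x w).
    by rewrite -vE; apply: near_chart_inv => //; exact: open_nbhs_nbhs.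
  have nr : \forall w \near v, rep_dom F x y w.
    by apply: open_nbhs_nbhs; split => //; apply: rep_dom_open => // q; exact: (sF.1 q).
  near=> w; have Uw : U (chart_inv x w) by near: w.
  have [xw yw] : rep_dom F x y w by near: w.
  by rewrite /f /k /local_rep /= chart_mapK // GF // chart_invK.
(* Directional derivatives are products of a row with the Jacobian, so the chain rule says that the
   product of the Jacobians fixes every row. *)
have JJ (u : 'rV[R]_n) : u *m ('J f v *m 'J k (f v)) = u.
  rewrite mulmxA -deriveEjacobian // -deriveEjacobian //.
  rewrite (deriveE _ df) (deriveE _ dk) -[LHS]/(('d k (f v) \o 'd f v) u) -diff_comp //.
  rewrite -deriveE; last exact: differentiable_comp.
  by rewrite (near_eq_derive _ kf) derive_id.
have J1 : 'J f v *m 'J k (f v) = 1%:M.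
  by apply/row_matrixP => i; rewrite -[RHS]JJ -row_mul mul1mx.
exact (mulmx1_unit J1).1.
Unshelve. all: by end_near. Qed.

Lemma conformal_local_rep (g : lorentz_metric M) (h : lorentz_metric N) F c x y v a b :
  conformal_with g h F c -> smooth_map F -> atlas x -> atlas y -> rep_dom F x y v ->
  \sum_l \sum_m partial a (fun z => local_rep F x y z 0 l) v
     * h y (chart_inv y (local_rep F x y v)) l m * partial b (fun z => local_rep F x y z 0 m) v
  = c (chart_inv x v) * g x (chart_inv x v) a b.
Proof.
move=> cF sF ax ay vr; have [xv yv] := vr.
have dv := chart_dom_inv ax xv.
have := cF x y _ ax ay dv yv; rewrite /= chart_invK // => /matrixP /(_ a b).
rewrite [RHS]mxE => <-; rewrite /local_rep /= chart_mapK // -/(local_rep F x y).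
have df := local_rep_diff sF ax ay vr.
rewrite [RHS]mxE exchange_big /=; apply: eq_bigr => m _.
rewrite [X in _ = X * _]mxE [X in _ = _ * X]mxE (jacobianE b m df) mulr_suml.
by apply: eq_bigr => l _; rewrite (jacobianE a l df).
Qed.

(** Nonvanishing is not part of [conformal_with]. A zero of [c] would make the invertible matrix J h
    J^T vanish, impossible for positive [n]. *)
Lemma conformal_factor_neq0 (g : lorentz_metric M) (h : lorentz_metric N) F c x y v :
  (0 < n)%N -> conformal_with g h F c -> local_diffeo F -> atlas x -> atlas y ->
  rep_dom F x y v -> c (chart_inv x v) != 0.
Proof.
move=> n0 cF dF ax ay vr; have [xv yv] := vr.
have := cF x y _ ax ay (chart_dom_inv ax xv) yv; rewrite /= chart_invK //.
have uJ := local_diffeo_jacobian dF ax ay vr.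
have uh := lorentzian_mx_unit (metric_signature h ay yv).
move=> E; apply/eqP => c0; move: E; rewrite c0 scale0r => E.
have : 'J (local_rep F x y) v *m h y (F (chart_inv x v)) *m ('J (local_rep F x y) v)^T \in unitmx.
  by rewrite !unitmx_mul unitmx_tr uJ uh.
rewrite E unitmxE unitfE; case: (n) n0 => // n' _.
by rewrite det0 eqxx.
Qed.

End LocalRepresentation.

(** * From local to global uniqueness *)

Section Rigidity.
Context {R : realType} {n : nat} {M N : manifold R n}.
Hypothesis hn : (2 < n)%N.
Variables (g : lorentz_metric M) (h : lorentz_metric N) (F1 F2 : M -> N) (c1 c2 : M -> R).
Hypotheses (dF1 : local_diffeo F1) (dF2 : local_diffeo F2).
Hypotheses (cF1 : conformal_with g h F1 c1) (cF2 : conformal_with g h F2 c2).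

Let contF1 p : {for p, continuous F1}. Proof. exact: (dF1.1.1 p). Qed.
Let contF2 p : {for p, continuous F2}. Proof. exact: (dF2.1.1 p). Qed.

Lemma two_jet_determines_germ x y p : atlas x -> atlas y -> chart_dom x p ->
  chart_dom y (F1 p) -> F1 p = F2 p ->
  (forall a l, partial a (fun z => local_rep F1 x y z 0 l) (chart_map x p) =
               partial a (fun z => local_rep F2 x y z 0 l) (chart_map x p)) ->
  (forall a b l,
     partial a (partial b (fun z => local_rep F1 x y z 0 l)) (chart_map x p) =
     partial a (partial b (fun z => local_rep F2 x y z 0 l)) (chart_map x p)) ->
  \forall q \near p, F1 q = F2 q.
Proof.
move=> ax ay xp yF1 F12 J1 J2.
have n0 : (0 < n)%N by apply: leq_trans hn.
set v := chart_map x p.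
pose gc a b w := g x (chart_inv x w) a b; pose hc a b w := h y (chart_inv y w) a b.
have xv : chart_img x v by exact: chart_img_map.
have r1 : rep_dom F1 x y v by exact: rep_dom_map.
have r2 : rep_dom F2 x y v by apply: rep_dom_map; rewrite -?F12.
have gU : g x p \in unitmx by apply/lorentzian_mx_unit/metric_signature.
(* An invertible matrix of positive size has a nonzero entry; it becomes the denominator of
   [factor]. Diagonal entries may all vanish for a Lorentz metric, so any pair of indices is
   allowed. *)
have [a0 [b0 gab]] : exists a b, gc a b v != 0.
  apply: contrapT => H.
  have g0 : g x p = 0.
    apply/matrixP => a b; rewrite mxE; apply/eqP; apply: contrapT => /negP ab.
    by apply: H; exists a, b; rewrite /gc chart_mapK.
  have := mulVmx gU; rewrite g0 mulmx0 => /matrixP /(_ (Ordinal n0) (Ordinal n0)).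
  by rewrite !mxE eqxx => /esym/eqP; rewrite oner_eq0.
have gsm a b : smooth_fun (chart_img x) (gc a b) by exact: metric_component_smooth.
have N1 : \forall w \near v, rep_dom F1 x y w.
  by apply: open_nbhs_nbhs; split => //; apply: rep_dom_open.
have N2 : \forall w \near v, rep_dom F2 x y w.
  by apply: open_nbhs_nbhs; split => //; apply: rep_dom_open.
have N3 : \forall w \near v, gc a0 b0 w != 0.
  have cg : {for v, continuous (gc a0 b0)} by exact: Cr_continuous (gsm a0 b0 0%N) xv.
  have := cvgr_neq0 _ cg gab; exact.
have [r /= r0 rP] := (nbhs_ballP _ _).1 (filterI N1 (filterI N2 N3)).
(* Small enough for both representatives to be defined and for the chosen component of [g] to stay
   nonzero. *)
pose A := ball v r.
have oA : open A by exact: ball_open.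
have Av : A v by exact: ballxx.
have A1 w : A w -> rep_dom F1 x y w by move=> /rP [].
have A2 w : A w -> rep_dom F2 x y w by move=> /rP [_ []].
have A3 w : A w -> gc a0 b0 w != 0 by move=> /rP [_ []].
have Ax w : A w -> chart_img x w by move=> /A1 [].
have sub (B : set 'rV[R]_n) u : (forall w, A w -> B w) -> smooth_fun B u -> smooth_fun A u.
  by move=> AB su k; apply: Cr_sub (su k).
have sgA a b : smooth_fun A (gc a b) by exact: (sub _ _ Ax (gsm a b)).
have shB a b : smooth_fun (chart_img y) (hc a b) by exact: metric_component_smooth.
have gC a b w : A w -> gc a b w = gc b a w.
  move=> /Ax xw; rewrite /gc -[in LHS](lorentzian_mx_sym (metric_signature g ax (chart_dom_inv ax xw))).
  by rewrite mxE.
have hC a b w : chart_img y w -> hc a b w = hc b a w.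
  move=> yw; rewrite /hc -[in LHS](lorentzian_mx_sym (metric_signature h ay (chart_dom_inv ay yw))).
  by rewrite mxE.
have gUA w : A w -> \matrix_(a, b) gc a b w \in unitmx.
  move=> /Ax xw; rewrite (_ : \matrix_(a, b) _ = g x (chart_inv x w)); last first.
    by apply/matrixP => a b; rewrite mxE.
  exact/lorentzian_mx_unit/metric_signature/chart_dom_inv.
have f0 : local_rep F1 x y v = local_rep F2 x y v by rewrite !local_repE // F12.
have E : \forall w \near v, local_rep F1 x y w = local_rep F2 x y w.
  exact: (@two_jet_determines_near R n hn A (chart_img y) v oA Av (chart_img_open ay) gc hc
    sgA shB gC hC gUA a0 b0 A3 (local_rep F1 x y) (local_rep F2 x y)
    (fun w Aw => local_rep_mem (A1 w Aw)) (fun w Aw => local_rep_mem (A2 w Aw))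
    (fun l => sub _ _ A1 (local_rep_smooth_fun l dF1.1 ax ay))
    (fun l => sub _ _ A2 (local_rep_smooth_fun l dF2.1 ax ay))
    (c1 \o chart_inv x) (c2 \o chart_inv x)
    (fun a b w Aw => conformal_local_rep a b cF1 dF1.1 ax ay (A1 w Aw))
    (fun a b w Aw => conformal_local_rep a b cF2 dF2.1 ax ay (A2 w Aw))
    (fun w Aw => conformal_factor_neq0 n0 cF1 dF1 ax ay (A1 w Aw)) f0 J1 J2).
have Nv : \forall w \near v, local_rep F1 x y w = local_rep F2 x y w /\
    (rep_dom F1 x y w /\ rep_dom F2 x y w) by exact: (filterI E (filterI N1 N2)).
have Np := near_chart_map ax xp Nv.
have Nx := near_chart_dom ax xp.
near=> q.
have xq : chart_dom x q by near: q; exact: Nx.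
have [Eq [[_ y1] [_ y2]]] : local_rep F1 x y (chart_map x q) = local_rep F2 x y (chart_map x q) /\
    (rep_dom F1 x y (chart_map x q) /\ rep_dom F2 x y (chart_map x q)) by near: q; exact: Np.
move: Eq y1 y2; rewrite !local_repE // chart_mapK // => Eq y1 y2.
by rewrite -(chart_mapK ay y1) Eq chart_mapK.
Unshelve. all: by end_near. Qed.

Lemma eq_of_adherent (u1 u2 : 'rV[R]_n -> R) v : {for v, continuous u1} ->
  {for v, continuous u2} ->
  (forall U, nbhs v U -> exists2 w, U w & u1 w = u2 w) -> u1 v = u2 v.
Proof.
move=> cu1 cu2 H; apply/eqP; rewrite -subr_eq0; apply: contrapT => /negP u0.
have cu : {for v, continuous (u1 \- u2)} by exact: continuousB.
have [w + E] := H _ (cvgr_neq0 _ cu u0).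
by rewrite /= E subrr eqxx.
Qed.

(** At a limit of points with equal germs the 2-jets agree, the derivatives being continuous; the
    local theorem turns this back into equality of germs. *)
Lemma germ_agreement_closed : closed [set p : M | \forall q \near p, F1 q = F2 q].
Proof.
move=> p clp.
(* The values agree because [N] is Hausdorff; only then can both maps be read in one chart [y]. *)
have F12 : F1 p = F2 p.
  apply: (manifold_hausdorff (m := N)) => U V nU nV.
  have nU' : nbhs p (F1 @^-1` U) := contF1 nU.
  have nV' : nbhs p (F2 @^-1` V) := contF2 nV.
  have [q [Eq [Uq Vq]]] := clp _ (filterI nU' nV').
  exists (F1 q); split => //; rewrite (nbhs_singleton Eq); exact: Vq.
have [x ax xp] := atlas_cover p; have [y ay yF] := atlas_cover (F1 p).
have xv := chart_img_map xp.
have r1 : rep_dom F1 x y (chart_map x p) by exact: rep_dom_map.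
have r2 : rep_dom F2 x y (chart_map x p) by apply: rep_dom_map; rewrite -?F12.
have s1 l := local_rep_smooth_fun l dF1.1 ax ay.
have s2 l := local_rep_smooth_fun l dF2.1 ax ay.
have H U : nbhs (chart_map x p) U -> exists2 w, U w &
    {near w, local_rep F1 x y =1 local_rep F2 x y}.
  move=> nU; have nUp : nbhs p (fun z => U (chart_map x z)) := near_chart_map ax xp nU.
  have [q [Eq [Uq xq]]] := clp _ (filterI nUp (near_chart_dom ax xp : nbhs p (chart_dom x))).
  exists (chart_map x q) => //.
  have := @near_chart_inv _ _ _ _ _ (fun z => F1 z = F2 z) ax xq Eq.
  by apply: filterS => w Ew; rewrite /local_rep /= Ew.
have near_comp (w : 'rV[R]_n) l : {near w, local_rep F1 x y =1 local_rep F2 x y} ->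
    {near w, (fun z => local_rep F1 x y z 0 l) =1 (fun z => local_rep F2 x y z 0 l)}.
  move=> Ew; near=> z; have Hz : local_rep F1 x y z = local_rep F2 x y z by near: z; exact: Ew.
  by rewrite Hz.
have near_part (u1 u2 : 'rV[R]_n -> R) a (w : 'rV[R]_n) : {near w, u1 =1 u2} ->
    {near w, partial a u1 =1 partial a u2}.
  move=> Ew; near=> z; apply: near_eq_derive; near: z.
  exact: (near_join Ew).
apply: (two_jet_determines_germ ax ay xp yF F12) => [a l|a b l].
  apply: eq_of_adherent.
  - exact: (Cr_continuous (smooth_fun_partial a (s1 l) 0%N) r1).
  - exact: (Cr_continuous (smooth_fun_partial a (s2 l) 0%N) r2).
  - move=> U /H [w Uw Ew]; exists w; first exact Uw.
    exact: (nbhs_singleton (near_part _ _ a _ (near_comp _ l Ew))).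
apply: eq_of_adherent.
- exact: (Cr_continuous (smooth_fun_partial a (smooth_fun_partial b (s1 l)) 0%N) r1).
- exact: (Cr_continuous (smooth_fun_partial a (smooth_fun_partial b (s2 l)) 0%N) r2).
- move=> U /H [w Uw Ew]; exists w; first exact Uw.
  exact: (nbhs_singleton (near_part _ _ a _ (near_part _ _ b _ (near_comp _ l Ew)))).
Unshelve. all: by end_near. Qed.

Theorem conformal_rigidity (Xi : set M) : connected [set: M] ->
  agree_to_second_order F1 F2 Xi -> Xi !=set0 -> F1 = F2.
Proof.
move=> hconn [agr0 agr] [p Xp]; apply/funext => q.
pose E : set M := [set z : M | \forall q \near z, F1 q = F2 q].
suff : E = [set: M].
  by move=> ET; have /nbhs_singleton : E q by rewrite ET.
apply: hconn.
- exists p.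
  have [x [y [[ax ay] xp yF _ H]]] := agr p Xp.
  apply: (two_jet_determines_germ ax ay xp yF (agr0 p Xp)) => [a l|a b l].
    by have [] := H p Xp xp a a l.
  by have [] := H p Xp xp a b l.
- exists E; last by rewrite setTI.
  by rewrite openE => z; exact: nbhs_interior.
- exists E; last by rewrite setTI.
  exact: germ_agreement_closed.
Qed.

End Rigidity.

(** * Inextendible timelike curves *)

Section AffineLine.
Context {R : realType} {n : nat}.

Lemma smooth_on_line (z w : 'rV[R]_n) : smooth_on [set: R] (fun s : R => z + s *: w).
Proof.
have cst_smooth k (c : 'rV[R]_n) : Ck_on k [set: R] (cst c).
  elim: k c => [|k IH] c /=; first by move=> x _; exact: cst_continuous.
  split=> [x _|v]; first exact: differentiable_cst.
  have -> : (fun x => 'D_v (cst c) x) = cst (0 : 'rV[R]_n).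
    by apply/funext => x; exact: derive_cst.
  exact: IH.
have dl (s : R) : is_diff s (fun s : R => z + s *: w) (fun h => h *: w).
  by apply: is_diff_eq (is_diffD _ _) _; apply/funext => h /=; rewrite fctE add0r.
have difl (s : R) : differentiable (fun s : R => z + s *: w) s by case: (dl s).
case=> [|k] /=; first by move=> s _; exact: differentiable_continuous.
split=> // v.
have -> : (fun x => 'D_v (fun s : R => z + s *: w) x) = cst (v *: w).
  by apply/funext => s; rewrite deriveE // diff_val.
exact: cst_smooth.
Qed.

Lemma derive_line (z w : 'rV[R]_n) (t : R) : 'D_1 (fun s : R => z + s *: w) t = w.
Proof.
have dl : is_diff t (fun s : R => z + s *: w) (fun h => h *: w).
  by apply: is_diff_eq (is_diffD _ _) _; apply/funext => h /=; rewrite fctE add0r.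
have difl : differentiable (fun s : R => z + s *: w) t by case: dl.
by rewrite deriveE // diff_val scale1r.
Qed.

End AffineLine.

(** * Gluing straight segments along the integers *)

Section Segments.
Context {R : realType} {n : nat} {M : manifold R n}.
Variable K : chart R n M -> M -> 'rV[R]_n -> Prop.
Implicit Types (c : R -> M) (a b d s t : R).

(** Simpler than [smooth_piece]: one chart and constant velocity for the whole interval. It is
    stable under restriction and time translation, as the gluing requires. *)
Definition chart_segment c a b := exists (x : chart R n M) (z w : 'rV[R]_n),
  atlas x /\ forall s, a <= s <= b ->
    [/\ chart_dom x (c s), chart_map x (c s) = z + s *: w & K x (c s) w].

Lemma chart_segment_sub c a b a' b' : a <= a' -> b' <= b ->
  chart_segment c a b -> chart_segment c a' b'.
Proof.
move=> aa bb [x [z [w [ax H]]]]; exists x, z, w; split => // s /andP[s1 s2].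
by apply: H; rewrite (le_trans aa s1) (le_trans s2 bb).
Qed.

Lemma chart_segment_shift c c' a b d : (forall s, a <= s <= b -> c' s = c (s - d)) ->
  chart_segment c (a - d) (b - d) -> chart_segment c' a b.
Proof.
move=> cc [x [z [w [ax H]]]]; exists x, (z - d *: w), w; split => // s hs.
have hs' : a - d <= s - d <= b - d by rewrite !lerD2r.
have [H1 H2 H3] := H _ hs'; rewrite cc //; split => //.
by rewrite H2 scalerBl addrA addrAC.
Qed.

Lemma chart_segment_smooth c a b : chart_segment c a b -> smooth_piece K c a b.
Proof.
move=> [x [z [w [ax H]]]] t ht; have [H1 H2 H3] := H t ht.
exists x, (fun s => z + s *: w), [set: R]; split => //.
- by split => //; exact: openT.
- exact: smooth_on_line.
- by move=> s _ hs; have [] := H s hs.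
- by rewrite derive_line.
Qed.

(** Integer indices, because the curve has to be prolonged in both time directions. *)
Definition glue (G : int -> R -> M) : R -> M :=
  fun t => G (Num.floor t) (t - (Num.floor t)%:~R).

Variable G : int -> R -> M.
Hypothesis segG : forall i, chart_segment (G i) 0 1.
Hypothesis joinG : forall i, G i 1 = G (i + 1) 0.

Lemma glue_int (i : int) : glue G i%:~R = G i 0.
Proof. by rewrite /glue intrKfloor subrr. Qed.

(** At the right endpoint the floor already selects the next piece, and [joinG] identifies the two
    values. *)
Lemma glue_segment (i : int) : chart_segment (glue G) i%:~R (i%:~R + 1).
Proof.
apply: (@chart_segment_shift (G i) _ _ _ i%:~R); last by rewrite subrr addrAC subrr add0r.
move=> s /andP[s1]; rewrite le_eqVlt => /predU1P [->|s2].
  rewrite addrAC subrr add0r joinG -glue_int; congr glue.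
  by rewrite intrD.
rewrite /glue; suff -> : Num.floor s = i by [].
by apply: floor_def; rewrite s1 intrD.
Qed.

Definition has_subdivision c a b := exists (k : nat) (t : nat -> R),
  [/\ t 0%N = a, t k = b &
      forall i, (i < k)%N -> t i < t i.+1 /\ smooth_piece K c (t i) (t i.+1)].

Lemma has_subdivision1 c a b : a < b -> smooth_piece K c a b -> has_subdivision c a b.
Proof.
move=> ab sc; exists 1%N, (fun i => if i is 0 then a else b); split => //.
by case.
Qed.

Lemma has_subdivision_cons c a d b : a < d -> smooth_piece K c a d ->
  has_subdivision c d b -> has_subdivision c a b.
Proof.
move=> ad sc [k [t [t0 tk H]]]; exists k.+1, (fun i => if i is i'.+1 then t i' else a).
by split => // -[_|i ik]; [rewrite t0|exact: H].
Qed.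

Lemma glue_subdivision a b : a < b -> has_subdivision (glue G) a b.
Proof.
(* [N] bounds the number of integers still to be crossed; each step cuts at the first integer after
   [a]. *)
have main (N : nat) : forall a b, a < b -> b <= (Num.floor a)%:~R + 1 + N%:R ->
    has_subdivision (glue G) a b.
  elim: N => [|N IH] {}a {}b ab bN.
    rewrite addr0 in bN; apply: has_subdivision1 => //; apply: chart_segment_smooth.
    exact: chart_segment_sub (floor_le a) bN (glue_segment _).
  have am : a < (Num.floor a)%:~R + 1 by have := floorD1_gt a; rewrite intrD.
  have sm m : m <= (Num.floor a)%:~R + 1 -> smooth_piece K (glue G) a m.
    move=> hm; apply: chart_segment_smooth.
    exact: chart_segment_sub (floor_le a) hm (glue_segment _).
  have [bm|mb] := leP b ((Num.floor a)%:~R + 1).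
    by apply: has_subdivision1 => //; exact: sm.
  apply: (has_subdivision_cons am); first exact: sm.
  have fm : Num.floor ((Num.floor a)%:~R + 1 : R) = Num.floor a + 1.
    by rewrite -[RHS](@intrKfloor R) intrD.
  by apply: IH => //; rewrite fm intrD; move: bN; rewrite -natr1; lra.
move=> ab; apply: (main `|Num.floor b - Num.floor a|%N) => //.
have fab : Num.floor a <= Num.floor b by apply: le_floor; exact: ltW.
rewrite natr_absz ger0_norm ?subr_ge0 // intrD rmorphN /= addrAC addrC.
have := floorD1_gt b; rewrite intrD => /ltW; lra.
Qed.

Lemma glue_piecewise_smooth : piecewise_smooth_curve K (glue G) [set: R].
Proof.
split; first by move=> x y _ _ z _.
  by exists 0, 1; split => //; exact: ltr01.
by move=> a b _ _; exact: glue_subdivision.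
Qed.

End Segments.

(** * Timelike curves without endpoints *)

Section InextendibleCurves.
Context {R : realType} {n : nat} {M : manifold R n}.
Context (g : lorentz_metric M) (X : time_orientation g).

Local Notation segment := (chart_segment (future_timelike X)).

(** A curve with an endpoint eventually stays in every neighborhood of it; a step out of an exitable
    neighborhood prevents this. One segment leaves at both ends, to serve the future and the
    past. *)
Definition exitable (U : set M) := forall p, U p -> exists c : R -> M,
  [/\ c 0 = p, segment c (-1) 1, ~ U (c 1) & ~ U (c (-1))].

Lemma inner_form_continuous x (u : M -> 'rV[R]_n) (w v : 'rV[R]_n) : atlas x ->
  chart_img x v -> (forall i, Cr 0 (chart_img x) (fun v => u (chart_inv x v) 0 i)) ->
  {for v, continuous (fun v => inner g x (chart_inv x v) (u (chart_inv x v)) w)}.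
Proof.
move=> ax xv cu; have oI := chart_img_open ax.
have C : Cr 0 (chart_img x) (fun v => inner g x (chart_inv x v) (u (chart_inv x v)) w).
  have Cj j : Cr 0 (chart_img x)
      ((fun v => \sum_i u (chart_inv x v) 0 i * g x (chart_inv x v) i j) \* cst (w 0 j)).
    apply: (CrM oI); last exact: Cr_cst.
    apply: (Cr_sum oI) => i; apply: (CrM oI); first exact: cu.
    exact: (metric_component_smooth g i j ax 0%N).
  apply: (eq_Cr oI) (Cr_sum oI Cj) => z _.
  by rewrite /inner mxE; apply: eq_bigr => j _; rewrite !mxE.
exact: Cr_continuous C xv.
Qed.

Lemma innerZr x p u (k : R) w : inner g x p u (k *: w) = k * inner g x p u w.
Proof. by rewrite /inner linearZ /= -scalemxAr mxE. Qed.

Lemma innerZl x p u (k : R) w : inner g x p (k *: u) w = k * inner g x p u w.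
Proof. by rewrite /inner -!scalemxAl mxE. Qed.

Lemma inner0l x p w : inner g x p 0 w = 0.
Proof. by rewrite /inner !mul0mx mxE. Qed.

(* In a small coordinate ball the straight lines in the constant direction
   [X q] are timelike, and they leave the ball in both directions. *)
Lemma exitable_nbhs (q : M) : exists2 U : set M, nbhs q U & exitable U.
Proof.
have [x ax xq] := atlas_cover q.
set v0 := chart_map x q; set w0 := X x q.
have xv0 : chart_img x v0 by exact: chart_img_map.
have w0t : inner g x q w0 w0 < 0 by exact: (time_field_timelike X ax xq).
have w0n : w0 != 0 by apply/eqP => w00; move: w0t; rewrite w00 inner0l ltxx.
have c1 := @inner_form_continuous x (cst w0) w0 v0 ax xv0 (fun i => @Cr_cst _ _ 0 _ (w0 0 i)).
have cX i : Cr 0 (chart_img x) (fun v => X x (chart_inv x v) 0 i).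
  exact: (@smooth_on_Cr _ _ _ (chart_img_open ax) 0 _ _ (X x \o chart_inv x) 0 i
    (time_field_smooth X ax)).
have c2 := @inner_form_continuous x (X x) w0 v0 ax xv0 cX.
have N1 : \forall v \near v0, inner g x (chart_inv x v) w0 w0 < 0.
  by apply: (cvgr_lt _ c1); rewrite /v0 chart_mapK.
have N2 : \forall v \near v0, inner g x (chart_inv x v) (X x (chart_inv x v)) w0 < 0.
  by apply: (cvgr_lt _ c2); rewrite /v0 chart_mapK.
have N3 : \forall v \near v0, chart_img x v.
  by apply: open_nbhs_nbhs; split => //; exact: chart_img_open.
have [r /= r0 rP] := (nbhs_ballP _ _).1 (filterI N1 (filterI N2 N3)).
(* A start within [rho] of [v0] and a displacement of norm [2 * rho] end farther than [rho] from
   [v0], while the segment stays within [3 * rho < r]. *)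
pose rho := r / 4.
have rho0 : 0 < rho by rewrite divr_gt0.
exists [set p | chart_dom x p /\ ball v0 rho (chart_map x p)].
  have B1 : nbhs q (fun p => ball v0 rho (chart_map x p)).
    by apply: (near_chart_map ax xq); exact: nbhsx_ballx.
  exact: (filterI (near_chart_dom ax xq : nbhs q (chart_dom x)) B1).
move=> p [xp bp]; set z := chart_map x p.
pose k := 2 * rho / `|w0|; pose w := k *: w0.
have k0 : 0 < k by rewrite divr_gt0 ?mulr_gt0 // normr_gt0.
have nw : `|w| = 2 * rho.
  by rewrite /w normrZ gtr0_norm // /k divfK // normr_eq0.
have zb : `|v0 - z| < rho by move: bp; rewrite -ball_normE.
have inb (s : R) : -1 <= s <= 1 -> ball v0 r (z + s *: w).
  rewrite -ler_norml => s1; rewrite -ball_normE /= opprD addrA.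
  apply: le_lt_trans (ler_normB _ _) _; rewrite normrZ nw.
  have : `|s| * (2 * rho) <= 2 * rho by rewrite ler_piMl // mulr_ge0 // ltW.
  have rE : r = 4 * rho by rewrite /rho mulrC divfK.
  move: zb; rewrite rE; lra.
have img (s : R) : -1 <= s <= 1 -> chart_img x (z + s *: w) by move=> /inb /rP [_ []].
have out (s : R) : -1 <= s <= 1 -> `|s| = 1 ->
    ~ (chart_dom x (chart_inv x (z + s *: w)) /\
       ball v0 rho (chart_map x (chart_inv x (z + s *: w)))).
  move=> s1 ns [_]; rewrite chart_invK; [|by []|exact: img].
  rewrite -ball_normE /= opprD addrA => H.
  have : `|s *: w| <= `|v0 - z - s *: w| + `|v0 - z|.
    by rewrite -{1}(subKr (v0 - z) (s *: w)) [leRHS]addrC; exact: ler_normB.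
  rewrite normrZ ns mul1r nw; move: H zb; lra.
have h1 : -1 <= (1 : R) <= 1 by rewrite lexx ge0_cp.
have h2 : -1 <= (-1 : R) <= 1 by rewrite lexx ge0_cp.
exists (fun s => chart_inv x (z + s *: w)); split.
- by rewrite scale0r addr0 chart_mapK.
- exists x, z, w; split => // s hs; split.
  + by apply: chart_dom_inv => //; exact: img.
  + by rewrite chart_invK //; exact: img.
  + have [I1 [I2 _]] := rP _ (inb s hs); split.
      by rewrite /timelike /w innerZl innerZr !pmulr_rlt0.
    by rewrite /w innerZr pmulr_rlt0.
- by apply: out; rewrite // normr1.
- by apply: out; rewrite // normrN1.
Qed.

(* Every point is moved out of its neighborhood of index [k] for infinitely
   many steps [i], because each [k] is [logn 2 i.+1] infinitely often. *)
Lemma inextendible_timelike_curve (p : M) : exists c : R -> M,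
  [/\ timelike_curve X c [set: R], past_inextendible c [set: R],
      future_inextendible c [set: R] & c 0 = p].
Proof.
have [B cB [Bo Bb]] := manifold_second_countable M.
have [f finj] := countable_injP _ cB.
have small (q : M) : exists2 b, B b & [/\ nbhs q b, b q & exitable b].
  have [U nU eU] := exitable_nbhs q.
  have [b [bB bq] bU] := Bb q U nU.
  exists b => //; split => //; first by apply: open_nbhs_nbhs; split => //; exact: Bo.
  move=> z bz; have [c [c0 sc c1 c2]] := eU z (bU z bz).
  by exists c; split => // /bU.
(* [kz] pairs the number of the basis set to be left with the current point. *)
pose Step (kz : nat * M) (c : R -> M) := [/\ c 0 = kz.2, segment c (-1) 1 &
  forall b, B b -> f b = kz.1 -> exitable b -> b kz.2 -> ~ b (c 1) /\ ~ b (c (-1))].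
have exStep kz : exists c, Step kz c.
  case: kz => k z.
  (* By injectivity of [f] at most one basis set has number [k]. If it is not exitable or does not
     contain [z], the exit condition is void and any segment through [z] will do. *)
  have [[b [Bb' fb eb bz]]|H] := pselect (exists b, [/\ B b, f b = k, exitable b & b z]).
    have [c [c0 sc c1 c2]] := eb z bz; exists c; split => // b' Bb'' fb' _ _.
    have -> : b' = b; last by [].
    by apply: finj; rewrite ?inE // fb fb'.
  have [b Bb' [_ bz eb]] := small z; have [c [c0 sc _ _]] := eb z bz.
  by exists c; split => // b' Bb'' fb' eb' bz'; exfalso; apply: H; exists b'.
have [step stepP] := boolp.choice exStep.
pose P := fix P i : M := if i is i'.+1 then step (logn 2 i'.+1, P i') 1 else p.
pose Q := fix Q i : M := if i is i'.+1 then step (logn 2 i'.+1, Q i') (-1) else p.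
pose G (i : int) : R -> M := match i with
  | Posz i => step (logn 2 i.+1, P i)
  (* [Negz i] is the integer -(i+1): its piece is the past half of a step, run from time -1 to 0,
     hence the shift by 1. *)
  | Negz i => fun s => step (logn 2 i.+1, Q i) (s - 1)
  end.
have G0 kz : step kz 0 = kz.2 by have [] := stepP kz.
have segG i : segment (G i) 0 1.
  case: i => i /=.
    have [_ H _] := stepP (logn 2 i.+1, P i); by apply: chart_segment_sub H.
  have [_ H _] := stepP (logn 2 i.+1, Q i).
  apply: (chart_segment_shift (c := step (logn 2 i.+1, Q i)) (d := 1)) => //.
  apply: chart_segment_sub H; first by rewrite sub0r.
  by rewrite subrr ler01.
have joinG i : G i 1 = G (i + 1) 0.
  case: i => [i|[|i]].
  - have -> : Posz i + 1 = Posz i.+1 by rewrite -addn1.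
    by rewrite /= G0.
  - have -> : Negz 0 + 1 = Posz 0 by [].
    by rewrite /= subrr !G0.
  - have -> : Negz i.+1 + 1 = Negz i by rewrite !NegzE; lia.
    by rewrite /= subrr sub0r G0.
pose c := glue G.
have cP i : c i%:R = P i.
  by rewrite -[i%:R]/((Posz i)%:~R) /c glue_int /= G0.
have cQ i : c (- i%:R) = Q i.
  case: i => [|i]; first by rewrite oppr0 (cP 0%N).
  have -> : - i.+1%:R = (Negz i)%:~R :> R by rewrite NegzE rmorphN.
  by rewrite /c glue_int /= sub0r.
have often k (t0 : R) : exists i, logn 2 i.+1 = k /\ t0 <= i%:R.
  pose m := (Num.truncn `|t0|).+1.
  (* The number i+1 is 2^k times an odd number, so its 2-adic valuation is [k]; a large odd factor
     makes [i] exceed [t0]. *)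
  exists (2 ^ k * m.*2.+1).-1.
  have pos : (0 < 2 ^ k * m.*2.+1)%N by rewrite muln_gt0 expn_gt0.
  rewrite prednK //; split.
    by rewrite lognM ?expn_gt0 // pfactorK // lognE dvdn2 /= odd_double addn0.
  have mt : t0 < m%:R by apply: le_lt_trans (ler_norm _) (truncnS_gt _).
  apply: le_trans (ltW mt) _; rewrite ler_nat.
  have : (0 < 2 ^ k)%N by rewrite expn_gt0.
  rewrite -muln2; move: (2 ^ k)%N pos => e; nia.
exists c; split.
- exact: glue_piecewise_smooth.
(* Near a past endpoint all vertices [Q i] with [i] large lie in [b], yet infinitely many of the
   steps are chosen to leave [b]. *)
- move=> [q qend]; have [b Bb' [nb bq eb]] := small q.
  have [t0 _ H] := qend b nb.
  have [i [fi ti]] := often (f b) (- t0).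
  have b1 : b (Q i) by rewrite -cQ; apply: H => //; rewrite lerNl.
  have b2 : b (Q i.+1).
    by rewrite -cQ; apply: H => //; rewrite lerNl (le_trans ti) // ler_nat.
  have [_ _ /(_ b Bb' (esym fi) eb b1) [_]] := stepP (logn 2 i.+1, Q i).
  exact.
- move=> [q qend]; have [b Bb' [nb bq eb]] := small q.
  have [t0 _ H] := qend b nb.
  have [i [fi ti]] := often (f b) t0.
  have b1 : b (P i) by rewrite -cP; apply: H.
  have b2 : b (P i.+1).
    by rewrite -cP; apply: H => //; rewrite (le_trans ti) // ler_nat.
  have [_ _ /(_ b Bb' (esym fi) eb b1) [+ _]] := stepP (logn 2 i.+1, P i).
  exact.
- by rewrite (cP 0%N).
Qed.

Lemma timelike_causal_curve c I : timelike_curve X c I -> causal_curve X c I.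
Proof.
move=> [iI nI H]; split => // a b Ia Ib ab.
have [k [t [t0 tk Ht]]] := H a b Ia Ib ab; exists k, t; split => // i ik.
have [tt sp] := Ht i ik; split => // s hs.
have [x [u [U [H1 H2 H3 H4 [H5 H6]]]]] := sp s hs; exists x, u, U; split => //.
split; last exact: H6.
split; last exact: ltW.
by apply/eqP => v0; move: H5; rewrite /timelike v0 inner0l ltxx.
Qed.

End InextendibleCurves.

Theorem theorem1p6 (R : realType) (n : nat) (hn : (3 <= n)%N)
    (M : manifold R n) (g : lorentz_metric M)
    (hconn : connected [set: M])
    (O : set (chart R n M)) (hO : is_orientation O)
    (X : time_orientation g) (hgh : globally_hyperbolic X)
    (N : manifold R n) (h : lorentz_metric N)
    (S : set M) (hS : spacelike_cauchy_hypersurface X S)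
    (Omega : set M) (hOmega : Omega `<=` S)
    (F1 F2 : M -> N) (c1 c2 : M -> R)
    (hF1 : local_diffeo F1) (hF2 : local_diffeo F2)
    (hc1 : conformal_with g h F1 c1) (hc2 : conformal_with g h F2 c2)
    (hagree : agree_to_second_order F1 F2 Omega) :
  (forall p, (future_cauchy_development X Omega `|`
              past_cauchy_development X Omega) p -> F1 p = F2 p) /\
  (Omega = S -> F1 = F2).
Proof.
have rigid : Omega !=set0 -> F1 = F2.
  exact (conformal_rigidity hn hF1 hF2 hc1 hc2 hconn hagree).
split=> [p Dp|OS]; last first.
  (* Extensionality supplies a point of [M]; the inextendible curve through it meets [S], which is
     therefore not empty. *)
  apply/funext => p.
  have [c [tc pc fc _]] := inextendible_timelike_curve X p.
  have [_ _ hC] := hS; have [t [[_ St] _]] := hC c _ tc pc fc.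
  by rewrite rigid //; exists (c t); rewrite OS.
have [c [tc pc fc c0]] := inextendible_timelike_curve X p.
have cc := timelike_causal_curve tc.
have cp : exists2 t, [set: R] t & c t = p by exists 0.
rewrite rigid //; case: Dp => Dp.
  by have [s _ Os] := Dp c _ cc pc cp; exists (c s).
by have [s _ Os] := Dp c _ cc fc cp; exists (c s).
Qed.
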